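(* Every infinite 3-connected cubic graph $G$ has a spanning subgraph that is 2-connected, bipartite, and faithful to $G$.
   Context: A ray is a one-way infinite path; two rays of a graph $H$ are equivalent in $H$ if for every finite $S\subseteq V(H)$ some component of $H-S$ contains tails of both; the equivalence classes are the ends of $H$. A subgraph $F$ of $G$ is faithful to $G$ if (i) every end of $G$ contains a ray of $F$, and (ii) any two rays of $F$ are equivalent in $F$ if and only if they are equivalent in $G$. *)

(* Defs.v *)
From Stdlib Require Import List Relations Arith.
Import ListNotations.

Section Graphs.
Variable V : Type.

Definition simple_graph (E : V -> V -> Prop) : Prop :=
  (forall x y, E x y -> E y x) /\ (forall x, ~ E x x).

Definition infinite_vertices : Prop :=
  ~ exists l : list V, forall v, In v l.

Definition cubic (E : V -> V -> Prop) : Prop :=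
  forall v, exists a b c,
    E v a /\ E v b /\ E v c /\ a <> b /\ a <> c /\ b <> c /\
    (forall w, E v w -> w = a \/ w = b \/ w = c).

Definition reach_in (E : V -> V -> Prop) (P : V -> Prop) (x y : V) : Prop :=
  P x /\ P y /\
  clos_refl_trans V (fun a b => E a b /\ P a /\ P b) x y.

Definition connected_on (E : V -> V -> Prop) (P : V -> Prop) : Prop :=
  (exists v, P v) /\ (forall x y, P x -> P y -> reach_in E P x y).

Definition k_connected (k : nat) (E : V -> V -> Prop) : Prop :=
  (exists l : list V, NoDup l /\ k < length l) /\
  (forall S : list V, length S < k -> connected_on E (fun v => ~ In v S)).

Definition bipartite (E : V -> V -> Prop) : Prop :=
  exists c : V -> bool, forall x y, E x y -> c x <> c y.

Definition ray (E : V -> V -> Prop) (r : nat -> V) : Prop :=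
  (forall n m, r n = r m -> n = m) /\ (forall n, E (r n) (r (S n))).

(* Rays r1 r2 are equivalent in E: for every finite vertex set S, some
   component of E - S contains tails of both rays.  The component is given
   by a representative vertex v not in S. *)
Definition rays_equiv (E : V -> V -> Prop) (r1 r2 : nat -> V) : Prop :=
  forall S : list V,
    exists v, ~ In v S /\
      (exists n, forall k, n <= k -> reach_in E (fun u => ~ In u S) v (r1 k)) /\
      (exists n, forall k, n <= k -> reach_in E (fun u => ~ In u S) v (r2 k)).

(* F (a subgraph of G) is faithful to G:
   (i) every end of G contains a ray of F;
   (ii) rays of F are equivalent in F iff they are equivalent in G. *)
Definition faithful (G F : V -> V -> Prop) : Prop :=
  (forall r, ray G r -> exists r', ray F r' /\ rays_equiv G r r') /\
  (forall r1 r2, ray F r1 -> ray F r2 ->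
     (rays_equiv F r1 r2 <-> rays_equiv G r1 r2)).

End Graphs.

Arguments infinite_vertices : clear implicits.

(* Main.v *)
Require Import Defs.
From Stdlib Require Import List Relations Arith.
From Stdlib Require Import Lia Classical ClassicalEpsilon.
Import ListNotations.

(** The spanning subgraph is the union of an increasing sequence of finite 2-connected
    bipartite subgraphs, each obtained from the previous one by adding an ear.  If three paths
    from a common vertex end in the current subgraph, two of them have the same parity relative
    to the colouring and form an ear that keeps the subgraph bipartite; a vertex lying on the
    wrong path then still lies on a shorter candidate path, so every vertex can be absorbed.

    For faithfulness, after each earlier stage S the graph G - S is split into its
    2-edge-connected components, and all ears are chosen so that the part of the subgraph in
    each such component stays connected outside S.  This is possible because a component without
    bridges can be left and re-entered: an ear through a component that already meets the
    subgraph gets an end in it.  A ray crosses only finitely many bridges of G - S, as the parts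
    between consecutive bridges send edges to S by 3-connectivity; so equivalent rays of G
    end up in the same component. *)

Ltac splits := repeat match goal with |- _ /\ _ => split end.

Lemma NoDup_app_disj (A : Type) (l1 l2 : list A) x : NoDup (l1 ++ l2) -> In x l1 -> In x l2 -> False.
Proof.
intros nd h1 h; destruct (in_split _ _ h1) as [m1 [m2 ->]].
rewrite <- app_assoc in nd; apply NoDup_remove_2 in nd; apply nd.
apply in_or_app; right; apply in_or_app; now right.
Qed.

(** * Walks *)

Section Walks.
Variable V : Type.
Implicit Types (R : V -> V -> Prop) (l s : list V).

Local Notation rt := (clos_refl_trans V).

(* The list contains the inner vertices only. *)
Fixpoint walk R (x : V) l (y : V) : Prop :=
  match l with
  | [] => R x y
  | z :: l' => R x z /\ walk R z l' y
  end.

Lemma rt_mono R R' : (forall a b, R a b -> R' a b) ->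
  forall x y, rt R x y -> rt R' x y.
Proof.
intros H x y r; induction r.
- now apply rt_step, H.
- apply rt_refl.
- now apply rt_trans with y.
Qed.

Lemma rt_sym R : (forall a b, R a b -> R b a) ->
  forall x y, rt R x y -> rt R y x.
Proof.
intros H x y r; induction r.
- now apply rt_step, H.
- apply rt_refl.
- now apply rt_trans with y.
Qed.

Lemma walk_app R x l1 z l2 y :
  walk R x (l1 ++ z :: l2) y <-> walk R x l1 z /\ walk R z l2 y.
Proof.
revert x; induction l1 as [|w l1 IH]; intros x; simpl; [tauto|].
rewrite IH; tauto.
Qed.

Lemma walk_mono R R' x l y :
  (forall a b, In a (x :: l) -> In b (l ++ [y]) -> R a b -> R' a b) ->
  walk R x l y -> walk R' x l y.
Proof.
revert x; induction l as [|w l IH]; intros x H; simpl.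
- apply H; simpl; auto.
- intros [h1 h2]; split; [apply H; simpl; auto|].
  apply IH; auto; intros a b ha hb; apply H; simpl; auto.
Qed.

Lemma walk_rev R : (forall a b, R a b -> R b a) ->
  forall l x y, walk R x l y -> walk R y (rev l) x.
Proof.
intros H; induction l as [|w l IH]; intros x y; simpl; auto.
intros [h1 h2]; apply walk_app; split; simpl; auto.
Qed.

Lemma walk_rt_from R x l y : walk R x l y -> forall z, In z (x :: l ++ [y]) ->
  rt (fun a b => R a b /\ In a (x :: l ++ [y]) /\ In b (x :: l ++ [y])) x z.
Proof.
revert x; induction l as [|w l IH]; intros x h z hz.
- destruct hz as [<-|[<-|[]]]; [apply rt_refl|apply rt_step].
  simpl; auto.
- destruct h as [h1 h2], hz as [<-|hz]; [apply rt_refl|].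
  apply rt_trans with w; [apply rt_step; simpl; auto|].
  eapply rt_mono; [|apply IH; [exact h2|exact hz]].
  intros a b [h3 [h4 h5]]; repeat split; auto; now right.
Qed.

Lemma walk_rt R x l y (P : V -> Prop) : (forall a b, R a b -> R b a) ->
  walk R x l y -> (forall z, In z (x :: l ++ [y]) -> P z) ->
  forall u v, In u (x :: l ++ [y]) -> In v (x :: l ++ [y]) ->
  rt (fun a b => R a b /\ P a /\ P b) u v.
Proof.
intros Rs h hP u v hu hv.
assert (E : forall z, In z (x :: l ++ [y]) -> rt (fun a b => R a b /\ P a /\ P b) x z).
{ intros z hz; eapply rt_mono; [|exact (walk_rt_from R x l y h z hz)].
  intros a b [h1 [h2 h3]]; auto. }
apply rt_trans with x; auto.
apply rt_sym; auto.
intros a b; firstorder.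
Qed.

(** Stop at the first vertex of [B]; whenever the start recurs on the walk built so far, cut out the
    loop. *)
Lemma rt_walk R (B : V -> Prop) p q : rt R p q -> B q -> ~ B p ->
  exists s y, walk R p s y /\ B y /\ (forall z, In z s -> ~ B z) /\ NoDup (p :: s).
Proof.
intros h; apply clos_rt_rt1n in h; induction h as [p|p p' q h1 h2 IH].
- tauto.
- intros hq hp; destruct (classic (B p')) as [hp'|hp'].
  { exists [], p'; simpl; repeat split; auto; try tauto.
    constructor; [simpl; tauto|constructor]. }
  destruct (IH hq hp') as [s [y [w [hy [hs nd]]]]].
  destruct (classic (In p (p' :: s))) as [hin|hin].
  + destruct (in_split _ _ hin) as [s1 [s2 e]].
    assert (w' : walk R p (p' :: s) y) by (simpl; auto).
    rewrite e in w', nd; apply walk_app in w'.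
    exists s2, y; split; [tauto|split; [auto|split]].
    * intros z hz; assert (hz' : In z (p' :: s)).
      { rewrite e; apply in_or_app; simpl; auto. }
      destruct hz' as [<-|hz']; auto.
    * now apply NoDup_app_remove_l in nd.
  + exists (p' :: s), y; split; [simpl; auto|split; [auto|split]].
    * intros z [<-|hz]; auto.
    * now constructor.
Qed.

(** Cutting at the last vertex of [A] leaves a walk that never returns to [A]. This turns a walk
    starting on an ear into a path that leaves the ear for good. *)
Lemma walk_last R (A : V -> Prop) p s y : walk R p s y -> A p ->
  exists x s1 s2, p :: s = s1 ++ x :: s2 /\ A x /\ walk R x s2 y /\
    (forall z, In z s2 -> ~ A z).
Proof.
intros w hp.
assert (E : exists x s1 s2, p :: s = s1 ++ x :: s2 /\ A x /\
  (forall z, In z s2 -> ~ A z)).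
{ clear w; revert p hp; induction s as [|z s IH]; intros p hp.
  - exists p, [], []; auto.
  - destruct (classic (A z)) as [hz|hz].
    + destruct (IH z hz) as [x [s1 [s2 [e h]]]].
      exists x, (p :: s1), s2; simpl; rewrite e; auto.
    + destruct (IH p hp) as [x [[|q s1] [s2 [e h]]]]; injection e; intros; subst.
      * exists x, [], (z :: s2); repeat split; auto.
        intros z' [<-|h']; [auto|now apply h].
      * exists x, (q :: z :: s1), s2; auto. }
destruct E as [x [s1 [s2 [e [hx hs]]]]].
exists x, s1, s2; repeat split; auto.
destruct s1 as [|q s1]; injection e; intros; subst; auto.
now apply walk_app in w.
Qed.

Lemma first_split l (P : V -> Prop) : (forall z, In z l -> ~ P z) \/
  exists l1 z l2, l = l1 ++ z :: l2 /\ P z /\ forall w, In w l1 -> ~ P w.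
Proof.
induction l as [|x l IH]; [now left|].
destruct (classic (P x)) as [hx|hx].
- right; exists [], x, l; auto.
- destruct IH as [IH|[l1 [z [l2 [e [hz h]]]]]].
  + left; intros z [<-|hz]; auto.
  + right; exists (x :: l1), z, l2; rewrite e; repeat split; auto.
    intros w [<-|hw]; auto.
Qed.

End Walks.

(** * Counting as a measure for inductions *)

Section Count.
Variable T : Type.

Definition count (P : T -> Prop) (l : list T) : nat :=
  length (filter (fun t => if excluded_middle_informative (P t) then true else false) l).

Lemma count_le (P Q : T -> Prop) l : (forall t, In t l -> P t -> Q t) -> count P l <= count Q l.
Proof.
unfold count; induction l as [|t l IH]; intros H; simpl; auto.
assert (IH' := IH (fun t h => H t (or_intror h))).
destruct (excluded_middle_informative (P t)) as [p|p],
  (excluded_middle_informative (Q t)) as [q|q]; simpl; try lia.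
now destruct q; apply H; simpl; auto.
Qed.

Lemma count_lt (P Q : T -> Prop) l t0 : (forall t, In t l -> P t -> Q t) ->
  In t0 l -> Q t0 -> ~ P t0 -> count P l < count Q l.
Proof.
unfold count; induction l as [|t l IH]; intros H h q0 p0; simpl; [destruct h|].
assert (le := count_le P Q l (fun t h => H t (or_intror h))); unfold count in le.
destruct (excluded_middle_informative (P t)) as [p|p],
  (excluded_middle_informative (Q t)) as [q|q]; simpl; try lia.
- destruct h as [<-|h]; [tauto|].
  apply -> Nat.succ_lt_mono; apply IH; auto; intros; apply H; simpl; auto.
- now destruct q; apply H; simpl; auto.
- destruct h as [<-|h]; [tauto|].
  apply IH; auto; intros; apply H; simpl; auto.
Qed.

End Count.
(** * Two-edge-connected components and stages *)

Section Cubic.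
Variables (V : Type) (G : V -> V -> Prop).
Hypothesis Gsym : forall x y, G x y -> G y x.
Hypothesis Girr : forall x, ~ G x x.
Hypothesis Gcub : cubic V G.
Hypothesis Gconn : k_connected V 3 G.
Implicit Types (S X A B : V -> Prop) (x y z : V) (l : list V).

Local Notation rt := (clos_refl_trans V).

(** The pair [u], [v] need not be an edge, so quantifying over all pairs in [peq] also covers plain
    connectivity in [G - S]. *)
Definition gdel S u v x y : Prop :=
  G x y /\ ~ S x /\ ~ S y /\ ~ (x = u /\ y = v \/ x = v /\ y = u).

(* The classes of [peq S] are the vertex sets of the 2-edge-connected components of [G - S]. *)
Definition peq S x y : Prop :=
  ~ S x /\ ~ S y /\ forall u v, rt (gdel S u v) x y.

Lemma gdel_sym S u v x y : gdel S u v x y -> gdel S u v y x.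
Proof. unfold gdel; intros [h [h1 [h2 h3]]]; repeat split; auto; tauto. Qed.

Lemma peq_sym S x y : peq S x y -> peq S y x.
Proof.
intros [h1 [h2 h3]]; repeat split; auto.
intros u v; apply rt_sym; auto; apply gdel_sym.
Qed.

Lemma peq_trans S x y z : peq S x y -> peq S y z -> peq S x z.
Proof.
intros [h1 [h2 h3]] [h4 [h5 h6]]; repeat split; auto.
intros u v; apply rt_trans with y; auto.
Qed.

Lemma peq_refl S x : ~ S x -> peq S x x.
Proof. intros h; repeat split; auto; intros; apply rt_refl. Qed.

Lemma peq_anti S S' x y : (forall z, S z -> S' z) -> peq S' x y -> peq S x y.
Proof.
intros H [h1 [h2 h3]]; repeat split; auto.
intros u v; eapply rt_mono; [|apply (h3 u v)].
unfold gdel; intros a b [h4 [h5 [h6 h7]]]; repeat split; auto.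
Qed.

(* If an edge separated [z] from [x], it would have to lie both in [A] and in [B]. *)
Lemma peq_convex S A B z x y :
  (forall w, A w -> ~ S w) -> (forall w, B w -> ~ S w) ->
  (forall w, A w -> B w -> w = x) -> A x ->
  rt (fun a b => G a b /\ A a /\ A b) z x ->
  rt (fun a b => G a b /\ B a /\ B b) x y ->
  peq S z y -> peq S z x.
Proof.
intros hA hB hAB hx rA rB [h1 [h2 h3]]; repeat split; auto.
intros u v; destruct (classic (A u /\ A v)) as [[hu hv]|n].
- apply rt_trans with y; auto.
  apply rt_sym; [apply gdel_sym|].
  eapply rt_mono; [|exact rB].
  intros a b [g [ha hb]]; repeat split; auto.
  intros e; apply (Girr a); replace a with x at 1; [replace x with b; auto|].
  + apply hAB; auto; destruct e as [[-> ->]|[-> ->]]; auto.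
  + symmetry; apply hAB; auto; destruct e as [[-> ->]|[-> ->]]; auto.
- eapply rt_mono; [|exact rA].
  intros a b [g [ha hb]]; repeat split; auto.
  intros [[-> ->]|[-> ->]]; tauto.
Qed.

Lemma conn_minus (s : list V) : length s < 3 -> forall x y, ~ In x s -> ~ In y s ->
  rt (fun a b => G a b /\ ~ In a s /\ ~ In b s) x y.
Proof.
intros hs x y hx hy; destruct Gconn as [_ h].
destruct (h s hs) as [_ h']; now destruct (h' x y hx hy) as [_ [_ h'']].
Qed.

Lemma two_nbrs x v : exists w, G x w /\ w <> v.
Proof.
destruct (Gcub x) as [a [b [c [ga [gb [gc [ab _]]]]]]].
destruct (classic (a = v)) as [<-|n]; [exists b|exists a]; auto.
Qed.

(** Deleting the vertex [u] destroys the edge to [v] as well, and [G - u] is connected. An endpoint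
    equal to [u] first steps to a neighbour other than [v]. *)
Lemma peq_empty x y : peq (fun _ => False) x y.
Proof.
repeat split; auto; intros u v.
assert (H : forall p, exists p', p' <> u /\ rt (gdel (fun _ => False) u v) p p').
{ intros p; destruct (classic (p = u)) as [->|n].
  - destruct (two_nbrs u v) as [w [g n]]; exists w; split.
    + intros ->; exact (Girr _ g).
    + apply rt_step; repeat split; auto; intros [[_ e]|[e1 e2]]; [tauto|].
      subst; exact (Girr _ g).
  - exists p; split; auto; apply rt_refl. }
destruct (H x) as [x' [nx rx]], (H y) as [y' [ny ry]].
apply rt_trans with x'; auto; apply rt_trans with y'.
- eapply rt_mono; [|apply (conn_minus [u])]; simpl; auto; try (intros [e|[]]; auto).
  intros a b [g [ha hb]]; repeat split; auto; intros [[-> _]|[_ ->]]; tauto.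
- apply rt_sym; auto; apply gdel_sym.
Qed.

Lemma finite_nbrs (M : list V) : exists N, forall x y, In x M -> G x y -> In y N.
Proof.
induction M as [|x M [N IH]]; [exists []; simpl; tauto|].
destruct (Gcub x) as [a [b [c [_ [_ [_ [_ [_ [_ h]]]]]]]]].
exists (a :: b :: c :: N); intros x' y [<-|hx] g; simpl.
- destruct (h y g) as [-> | [-> | ->]]; auto.
- do 3 right; eauto.
Qed.

(** The deleted set [S] is either a level or [eq s]; the latter makes [stage_conn] express
    2-connectivity. *)
Definition hst X (c : V -> bool) S a b : Prop :=
  G a b /\ c a <> c b /\ X a /\ X b /\ ~ S a /\ ~ S b.

(* [X] carries the bipartite graph formed by the edges of [G] inside [X] that are not
   monochromatic under [c].  The last field relates it to the earlier stages [L]. *)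
Record stage X (c : V -> bool) (L : list (V -> Prop)) : Prop := {
  stage_fin : exists l, forall x, X x -> In x l;
  stage_three : exists x y z, X x /\ X y /\ X z /\ x <> y /\ x <> z /\ y <> z;
  stage_conn : forall s x y, X x -> X y -> x <> s -> y <> s -> rt (hst X c (eq s)) x y;
  stage_sub : forall S, In S L -> forall x, S x -> X x;
  stage_chain : forall S S', In S L -> In S' L ->
    (forall x, S x -> S' x) \/ (forall x, S' x -> S x);
  stage_empty : In (fun _ => False) L;
  stage_peq : forall S, In S L -> forall x y, X x -> X y -> peq S x y -> rt (hst X c S) x y
}.

Lemma hst_sym X c S a b : hst X c S a b -> hst X c S b a.
Proof. unfold hst; intuition. Qed.

Lemma hst_extend X X' c c' S : (forall x, X x -> X' x) -> (forall x, X x -> c' x = c x) ->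
  forall x y, rt (hst X c S) x y -> rt (hst X' c' S) x y.
Proof.
intros h1 h2; apply rt_mono; intros a b [h3 [h4 [h5 [h6 h7]]]].
repeat split; auto; try tauto; rewrite !h2; auto.
Qed.

(** * Degrees and cells in a stage *)

Section Stage.
Variables (X : V -> Prop) (c : V -> bool) (L : list (V -> Prop)).
Hypothesis st : stage X c L.

Lemma stage_third p q : exists t, X t /\ t <> p /\ t <> q.
Proof.
destruct (stage_three _ _ _ st) as [x [y [z [hx [hy [hz [xy [xz yz]]]]]]]].
destruct (classic (x = p \/ x = q)) as [h|h]; [|exists x; tauto].
destruct (classic (y = p \/ y = q)) as [h'|h']; [|exists y; tauto].
exists z; repeat split; auto; intros ->; destruct h, h'; subst; congruence.
Qed.

(** Delete [p] and take the first step of a walk from [x] to a third vertex of the stage; if [p] is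
    [x], delete another vertex instead. *)
Lemma stage_nbr_avoid x p : X x -> exists y, X y /\ G x y /\ y <> p.
Proof.
assert (H : forall s t, X x -> X t -> x <> s -> t <> s -> x <> t ->
  exists y, X y /\ G x y /\ y <> s).
{ intros s t hx ht xs ts xt; assert (r := stage_conn _ _ _ st s x t hx ht xs ts).
  apply clos_rt_rt1n in r; destruct r as [|y t [g [_ [_ [hy [_ n]]]]] _]; [tauto|].
  exists y; repeat split; auto. }
intros hx; destruct (classic (x = p)) as [<-|n].
- destruct (stage_third x x) as [s [_ [hs _]]].
  destruct (stage_third x s) as [t [ht [tx ts]]].
  destruct (H s t) as [y [hy [g _]]]; auto.
  exists y; repeat split; auto; intros ->; exact (Girr _ g).
- destruct (stage_third x p) as [t [ht [tx ts]]]; apply (H p t); auto.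
Qed.

(** Two of the three neighbours of [x] already lie in [X]. *)
Lemma outside_unique x z1 z2 : X x -> G x z1 -> G x z2 -> ~ X z1 -> ~ X z2 -> z1 = z2.
Proof.
intros hx g1 g2 n1 n2; destruct (stage_nbr_avoid x x hx) as [y1 [h1 [g3 _]]].
destruct (stage_nbr_avoid x y1 hx) as [y2 [h2 [g4 n]]].
destruct (Gcub x) as [a [b [d [_ [_ [_ [_ [_ [_ h]]]]]]]]].
apply NNPP; intros n'.
assert (y1 <> z1) by congruence; assert (y1 <> z2) by congruence.
assert (y2 <> z1) by congruence; assert (y2 <> z2) by congruence.
destruct (h _ g1) as [-> | [-> | ->]], (h _ g2) as [-> | [-> | ->]],
  (h _ g3) as [-> | [-> | ->]], (h _ g4) as [-> | [-> | ->]]; congruence.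
Qed.

Definition touched z S : Prop := exists y, X y /\ peq S z y.

(* The smallest of the components around [z], over all levels, that meet [X]. *)
Definition cell z x : Prop := forall S, In S L -> touched z S -> peq S z x.

(** The levels form a chain and the empty level is always touched, so there is a largest touched
    level. Larger levels have finer classes, so its class is the whole intersection. *)
Lemma cell_peq z : exists S, In S L /\ touched z S /\ forall x, cell z x <-> peq S z x.
Proof.
assert (E : exists S, In S L /\ touched z S /\
  forall S', In S' L -> touched z S' -> forall x, S' x -> S x).
{ assert (H : forall L', incl L' L -> (exists S, In S L' /\ touched z S) ->
    exists S, In S L' /\ touched z S /\
    forall S', In S' L' -> touched z S' -> forall x, S' x -> S x).
  { induction L' as [|S L' IH]; intros hi [S0 [h0 t0]]; [destruct h0|].
    destruct (classic (exists S, In S L' /\ touched z S)) as [ex|nex].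
    - destruct IH as [S1 [h1 [t1 m1]]]; auto.
      { intros a ha; apply hi; now right. }
      destruct (classic (touched z S)) as [t|nt].
      + destruct (stage_chain _ _ _ st S S1) as [i|i]; try (apply hi; simpl; auto).
        * exists S1; repeat split; simpl; auto.
          intros S' [<-|h'] t'; [exact i|exact (m1 S' h' t')].
        * exists S; repeat split; simpl; auto.
          intros S' [<-|h'] t' x hx; auto; apply i; eauto.
      + exists S1; repeat split; simpl; auto.
        intros S' [<-|h'] t'; [tauto|exact (m1 S' h' t')].
    - destruct h0 as [->|h0]; [|destruct nex; eauto].
      exists S0; repeat split; simpl; auto.
      intros S' [<-|h'] t'; auto; destruct nex; eauto. }
  apply H; [apply incl_refl|].
  exists (fun _ => False); split; [apply (stage_empty _ _ _ st)|].
  destruct (stage_three _ _ _ st) as [x [_ [_ [hx _]]]].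
  exists x; split; auto; apply peq_empty. }
destruct E as [S [h1 [h2 h3]]]; exists S; split; [auto|split; [auto|]].
intros x; split; [intros h; now apply h|].
intros p S' h' t'; eapply peq_anti; [|exact p]; eauto.
Qed.

Lemma not_level z S : In S L -> ~ X z -> ~ S z.
Proof. intros h n s; apply n; exact (stage_sub _ _ _ st S h z s). Qed.

Lemma cell_refl z : ~ X z -> cell z z.
Proof. intros n S h _; apply peq_refl; now apply not_level. Qed.

(** A level touched by [z] is also touched by [z'], because both lie in the same class of it. *)
Lemma cell_incl z z' x : cell z z' -> cell z' x -> cell z x.
Proof.
intros h h' S hS t; assert (p := h S hS t); apply peq_trans with z'; auto.
apply h'; auto; destruct t as [y [hy q]]; exists y; split; auto.
apply peq_trans with z; auto; now apply peq_sym.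
Qed.

(** This is [peq_convex] at every level touched by [z]. Levels lie inside [X], which [A] avoids and
    [B] meets at most in [y]; and [y] avoids the level, being in a class of it. *)
Lemma cell_convex A B z x y :
  (forall w, A w -> ~ X w) -> (forall w, B w -> X w -> w = y) ->
  (forall w, A w -> B w -> w = x) -> A x ->
  rt (fun a b => G a b /\ A a /\ A b) z x ->
  rt (fun a b => G a b /\ B a /\ B b) x y ->
  cell z y -> cell z x.
Proof.
intros hA hB hAB hx rA rB h S hS t; assert (p := h S hS t).
apply (peq_convex S A B z x y); auto.
- intros w hw; apply not_level; auto.
- intros w hw s; assert (e : w = y).
  { apply hB; auto; exact (stage_sub _ _ _ st S hS w s). }
  subst; destruct p as [_ [n _]]; auto.
Qed.

End Stage.

Lemma walk_ends (R : V -> V -> Prop) x l y : walk V R x l y ->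
  forall z, In z (x :: l ++ [y]) -> exists w, R z w \/ R w z.
Proof.
revert x; induction l as [|w l IH]; intros x h z hz.
- destruct hz as [<-|[<-|[]]]; eauto.
- destruct h as [h1 h2], hz as [<-|hz]; eauto.
Qed.

Lemma walk_last_step (R : V -> V -> Prop) x l y : walk V R x l y ->
  exists w, In w (x :: l) /\ R w y.
Proof.
revert x; induction l as [|w l IH]; intros x h.
- exists x; simpl in *; auto.
- destruct h as [h1 h2], (IH w h2) as [w' [h3 h4]]; exists w'; simpl in *; tauto.
Qed.

Lemma walk_inner_rt (R : V -> V -> Prop) a l b : (forall u v, R u v -> R v u) ->
  walk V R a l b -> forall u v, In u l -> In v l ->
  rt (fun x y => R x y /\ In x l /\ In y l) u v.
Proof.
intros Rs w; destruct l as [|q l]; [intros u v []|].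
destruct w as [_ w]; destruct l as [|q' l] using rev_ind.
- intros u v [<-|[]] [<-|[]]; apply rt_refl.
- apply walk_app in w; destruct w as [w _].
  intros u v hu hv; apply (walk_rt V R q l q'); auto.
Qed.

(** Each inner vertex splits the path into two segments that meet only there, which is the situation
    of [peq_convex]. *)
Lemma walk_peq S z s y : walk V G z s y -> NoDup (z :: s ++ [y]) ->
  (forall w, In w (z :: s ++ [y]) -> ~ S w) -> peq S z y ->
  forall w, In w s -> peq S z w.
Proof.
intros wk nd hS p w hw; destruct (in_split _ _ hw) as [s1 [s2 ->]].
apply walk_app in wk; destruct wk as [w1 w2].
replace (z :: (s1 ++ w :: s2) ++ [y]) with ((z :: s1) ++ w :: (s2 ++ [y])) in *
  by (rewrite <- app_assoc; reflexivity).
apply (peq_convex S (fun t => In t (z :: s1 ++ [w])) (fun t => In t (w :: s2 ++ [y])) z w y).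
- intros t [<-|ht]; apply hS; [now left|].
  apply in_app_or in ht; apply in_or_app; simpl in *; tauto.
- intros t ht; apply hS; apply in_or_app; now right.
- intros t h1 h2; apply NNPP; intros n.
  assert (h1' : In t (z :: s1)).
  { destruct h1 as [h1|h1]; [now left|].
    apply in_app_or in h1; destruct h1 as [h1|[h1|[]]]; [now right|congruence]. }
  destruct h2 as [h2|h2]; [congruence|].
  rewrite app_comm_cons in nd; apply NoDup_remove_1 in nd.
  apply (NoDup_app_disj _ _ _ t nd h1').
  exact h2.
- right; apply in_or_app; simpl; auto.
- apply (walk_rt V G z s1 w); auto; [now left|right; apply in_or_app; simpl; auto].
- apply (walk_rt V G w s2 y); auto; [now left|right; apply in_or_app; simpl; auto].
- exact p.
Qed.

(** * Cell walks, candidate ears and third legs *)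

Section Stage.
Variables (X : V -> Prop) (c : V -> bool) (L : list (V -> Prop)).
Hypothesis st : stage X c L.

Local Notation cell := (cell X L).
Local Notation touched := (touched X).

(** The walk enters [a] from outside [X], and [a] has only one neighbour there. This is the tool for
    showing that a walk does not end at a given vertex. *)
Lemma last_outside z l a p : walk V G z l a -> X a -> (forall y, In y (z :: l) -> ~ X y) ->
  G a p -> ~ X p -> In p (z :: l).
Proof.
intros w ha hl g hp; destruct (walk_last_step _ _ _ _ w) as [q [hq gq]].
replace p with q; auto.
apply (outside_unique X c L st a); auto.
Qed.

(** The cell is a class of a touched level, so it has a path from [z] to [X] even without the edge
    from [z] to [h]. The path stays in the class by [walk_peq] and is cut at its first vertex in
    [X]. *)
Lemma cell_exit z h : ~ X z -> exists l a, walk V G z l a /\ NoDup (z :: l) /\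
  (forall y, In y l -> ~ X y) /\ X a /\ (forall y, In y l -> cell z y) /\ cell z a /\
  (l = [] -> a <> h).
Proof.
intros hz; destruct (cell_peq X c L st z) as [S [hS [[y0 [hy0 p]] hc]]].
assert (r : rt (gdel S z h) z y0) by apply p.
destruct (rt_walk V _ (eq y0) z y0 r) as [s [y1 [w [e [hs nd]]]]]; auto.
{ intros ->; auto. }
subst y1.
assert (wG : walk V G z s y0).
{ eapply walk_mono; [|exact w]; intros a b _ _ [g _]; exact g. }
assert (hs' : forall w, In w s -> cell z w).
{ intros x hx; apply hc; apply (walk_peq S z s y0); auto.
  - rewrite app_comm_cons; apply NoDup_app; auto.
    + constructor; [tauto|constructor].
    + intros t [<-|ht] [<-|[]]; [auto|now apply (hs y0)].
  - intros t ht; destruct (walk_ends _ _ _ _ w t ht) as [t' [[_ h']|[_ h']]]; tauto. }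
destruct (first_split V s X) as [hn|[l1 [a [l2 [e [ha h1]]]]]].
- exists s, y0; splits; auto.
  + now apply hc.
  + intros ->; simpl in w; intros ->; apply w; auto.
- rewrite e in wG, w, nd; apply walk_app in w; apply walk_app in wG.
  exists l1, a; splits; auto.
  + tauto.
  + rewrite app_comm_cons in nd; now apply NoDup_app_remove_r in nd.
  + intros y hy; apply hs'; rewrite e; apply in_or_app; now left.
  + apply hs'; rewrite e; apply in_or_app; simpl; auto.
  + intros -> ->; destruct w as [w _]; simpl in w; apply w; auto.
Qed.

(* Whenever the walk enters a smaller cell it is continued inside that cell, so that
   its end lies in the cells of all its vertices. *)
Lemma cell_walk z h : ~ X z -> exists l a, walk V G z l a /\ NoDup (z :: l) /\
  (forall y, In y l -> ~ X y) /\ X a /\ (forall y, In y l -> cell z y) /\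
  (forall y, In y (z :: l) -> cell y a) /\ (l = [] -> a <> h).
Proof.
(* Induction on the number of untouched levels: a vertex [y] of [cell z] touches every level that
   [z] touches, and one more if [z] is not in [cell y]. *)
remember (S (count (V -> Prop) (fun S => ~ touched z S) L)) as n eqn:hn.
assert (hn' : count (V -> Prop) (fun S => ~ touched z S) L < n) by lia; clear hn.
revert z h hn'; induction n as [|n IH]; intros z h hn hz; [lia|].
destruct (cell_exit z h hz) as [l [a [w [nd [hl [ha [cl [ca hh]]]]]]]].
destruct (first_split V l (fun y => ~ cell y z)) as [all|[l1 [y [l2 [e [ny h1]]]]]].
- exists l, a; splits; auto.
  intros y [<-|hy]; auto.
  apply (cell_incl X L y z a); auto; now apply NNPP, all.
- assert (hy : In y l) by (rewrite e; apply in_or_app; simpl; auto).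
  assert (czy := cl y hy).
  destruct (IH y y) as [l4 [a' [w4 [nd4 [hl4 [ha' [cl4 [ca' _]]]]]]]].
  + enough (count (V -> Prop) (fun S => ~ touched y S) L <
      count (V -> Prop) (fun S => ~ touched z S) L) by lia.
    assert (E : exists S, In S L /\ touched y S /\ ~ peq S y z).
    { apply NNPP; intros n'; apply ny; intros S hS t; apply NNPP; intros n2; apply n'; exists S; auto. }
    destruct E as [S [hS [t np]]].
    apply count_lt with S; auto.
    * intros S' hS' nt t'; apply nt; destruct t' as [y' [hy' p]].
      exists y'; split; auto; apply peq_trans with z; auto.
      apply peq_sym, czy; auto; now exists y'.
    * intros t'; apply np, peq_sym, czy; auto.
  + auto.
  + rewrite e in w; apply walk_app in w; destruct w as [w1 _].
    assert (h1' : forall x, In x l1 -> cell x z) by (intros; now apply NNPP, h1).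
    assert (hl1 : forall x, In x l1 -> In x l).
    { intros x hx; rewrite e; apply in_or_app; now left. }
    (* A common vertex [x] would give [cell y x] and [cell x z], hence [cell y z]. *)
    assert (dis : forall x, In x (z :: l1) -> In x (y :: l4) -> False).
    { intros x hx hx'; apply ny; apply (cell_incl X L y x z).
      - destruct hx' as [<-|hx']; auto; apply cell_refl with c; auto.
      - destruct hx as [<-|hx]; auto; apply cell_refl with c; auto. }
    assert (cza : cell z a').
    { apply (cell_incl X L z y a'); auto; apply ca'; now left. }
    exists (l1 ++ y :: l4), a'; splits; auto.
    * now apply walk_app.
    * rewrite app_comm_cons; apply NoDup_app; auto.
      rewrite e, app_comm_cons in nd; now apply NoDup_app_remove_r in nd.
    * intros x hx; apply in_app_or in hx; destruct hx as [hx|[<-|hx]]; auto.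
    * intros x hx; apply in_app_or in hx; destruct hx as [hx|[<-|hx]]; auto.
      apply (cell_incl X L z y x); auto.
    * intros x [<-|hx]; auto.
      apply in_app_or in hx; destruct hx as [hx|hx]; auto.
      apply (cell_incl X L x z a'); auto.
    * intros e'; destruct l1; discriminate.
Qed.

(* A candidate ear: adding it keeps the part of the subgraph in every component connected. *)
Definition hpath a l b : Prop :=
  X a /\ X b /\ a <> b /\ walk V G a l b /\ NoDup l /\ (forall z, In z l -> ~ X z) /\
  l <> [] /\ forall z, In z l -> cell z a \/ cell z b.

Lemma hpath_rev a l b : hpath a l b -> hpath b (rev l) a.
Proof.
intros [ha [hb [n [w [nd [hl [ne hc]]]]]]]; unfold hpath; splits; auto.
- now apply walk_rev.
- now apply NoDup_rev.
- intros z hz; apply hl; now apply in_rev.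
- intros e; apply ne; rewrite <- (rev_involutive l), e; reflexivity.
- intros z hz; destruct (hc z); auto; now apply in_rev.
Qed.

(** A cell walk from [v] leads back to [X]. It does not end in [h]: the single edge is excluded, and
    a longer walk would enter [h] through its only outside neighbour [v], which it cannot
    revisit. *)
Lemma hpath_start h v : X h -> ~ X v -> G h v -> exists l b, hpath h (v :: l) b.
Proof.
intros hh hv g; destruct (cell_walk v h hv) as [l [a [w [nd [hl [ha [cl [ca e]]]]]]]].
exists l, a; unfold hpath; splits; simpl; auto; try congruence.
- intros <-; destruct l as [|q l]; [now apply e|].
  destruct w as [w1 w2]; inversion nd as [|? ? n _]; apply n.
  apply (last_outside q l h); auto.
- intros z [<-|hz]; auto.
Qed.

Lemma leg_same a l b x0 : hpath a l b -> In x0 l -> cell x0 b -> ~ cell x0 a ->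
  exists x r d, In x l /\ walk V G x r d /\ X d /\ d <> a /\ d <> b /\ NoDup r /\
    (forall z, In z r -> ~ X z /\ ~ In z l) /\
    forall z, In z (x :: r) -> cell z d.
Proof.
intros [ha [hb [n [w [nd [hl [ne hc]]]]]]] hx0 cb ca.
destruct (exists_last ne) as [l' [p e]].
assert (hp : In p l) by (rewrite e; apply in_or_app; simpl; auto).
assert (gp : G p b).
{ rewrite e in w; apply walk_app in w; apply w. }
assert (cp : cell x0 p).
{ apply (cell_convex X c L st (fun t => In t l) (fun t => t = p \/ t = b) x0 p b); auto.
  - intros t [-> | ->] ht; auto; now destruct (hl p).
  - intros t ht [-> | ->]; auto; now destruct (hl b).
  - now apply (walk_inner_rt G a l b).
  - apply rt_step; auto. }
destruct (cell_walk p b (hl p hp)) as [s [d [ws [nds [hs [hd [cs [cd es]]]]]]]].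
destruct (walk_last V G (fun t => In t l) p s d ws hp) as [x [s1 [s2 [e2 [hx [wx hx2]]]]]].
assert (hs2 : forall z, In z (x :: s2) -> In z (p :: s)).
{ intros z hz; rewrite e2; apply in_or_app; now right. }
assert (xs : ~ In x s2).
{ intros h; apply (hx2 x); auto. }
exists x, s2, d; splits; auto.
- intros ->; apply ca; apply (cell_incl X L x0 p a); auto; apply cd; now left.
- intros ->; destruct s as [|q s]; [now apply es|].
  destruct ws as [_ ws]; inversion nds as [|? ? np _]; apply np.
  apply (last_outside q s b); auto.
- rewrite e2 in nds; apply NoDup_app_remove_l in nds; now inversion nds.
- intros z hz; split; auto.
  destruct (hs2 z) as [<-|h]; [now right|now destruct (hx2 p)|auto].
Qed.

(** Supplies the third path at a vertex of the ear, so that the parity argument has three paths to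
    choose from. The cell condition is what keeps both new combinations candidate ears. *)
Lemma leg a l b : hpath a l b ->
  exists x r d, In x l /\ walk V G x r d /\ X d /\ d <> a /\ d <> b /\ NoDup r /\
    (forall z, In z r -> ~ X z /\ ~ In z l) /\
    forall z, In z (x :: r) -> cell z d \/ cell z a /\ cell z b.
Proof.
intros hP.
destruct (classic (exists x0, In x0 l /\ cell x0 b /\ ~ cell x0 a)) as [[x0 [h1 [h2 h3]]]|n1].
{ destruct (leg_same a l b x0 hP h1 h2 h3) as [x [r [d H]]]; exists x, r, d.
  intuition. }
destruct (classic (exists x0, In x0 l /\ cell x0 a /\ ~ cell x0 b)) as [[x0 [h1 [h2 h3]]]|n2].
{ destruct (leg_same b (rev l) a x0 (hpath_rev a l b hP)) as
    [x [r [d [hx [w [hd [da [db [nd [hr cr]]]]]]]]]]; auto; [now apply in_rev in h1|].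
  exists x, r, d; splits; auto.
  - now apply in_rev.
  - intros z hz; destruct (hr z hz) as [h4 h5]; split; auto.
    intros h6; apply h5; now apply in_rev in h6. }
destruct hP as [ha [hb [n [w [nd [hl [ne hc]]]]]]].
(* In the remaining case every vertex of the ear has both ends in its cell, and 3-connectivity gives
   a path to [X] that avoids [a] and [b]. *)
assert (hab : forall x, In x l -> cell x a /\ cell x b).
{ intros x hx; destruct (hc x hx) as [h|h]; split; auto; apply NNPP; intros n'.
  - apply n2; exists x; auto.
  - apply n1; exists x; auto. }
assert (hp : exists p, In p l) by (destruct l as [|p l]; [tauto|exists p; now left]).
destruct hp as [p hp], (stage_third X c L st a b) as [t [ht [ta tb]]].
assert (r : rt (fun x y => G x y /\ ~ In x [a; b] /\ ~ In y [a; b]) p t).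
{ apply conn_minus; simpl; auto; intros [h|[h|[]]]; subst; try tauto; now apply (hl p). }
destruct (rt_walk V _ X p t r ht (hl p hp)) as [s [d [ws [hd [hs nds]]]]].
assert (dab : ~ In d [a; b]).
{ destruct (walk_ends _ _ _ _ ws d) as [w' h']; [right; apply in_or_app; simpl; auto|tauto]. }
assert (wsG : walk V G p s d).
{ eapply walk_mono; [|exact ws]; intros x y _ _ [g _]; exact g. }
destruct (walk_last V G (fun t => In t l) p s d wsG hp) as [x [s1 [s2 [e2 [hx [wx hx2]]]]]].
assert (hs2 : forall z, In z s2 -> ~ X z).
{ intros z hz; assert (hz' : In z (p :: s)).
  { rewrite e2; apply in_or_app; right; now right. }
  destruct hz' as [<-|hz']; auto. }
assert (nd2 : NoDup s2).
{ rewrite e2 in nds; apply NoDup_app_remove_l in nds; now inversion nds. }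
destruct (first_split V s2 (fun z => ~ (cell z a /\ cell z b)))
  as [all|[l1 [z [l2 [e [nz h1]]]]]].
- exists x, s2, d; splits; auto.
  + intros ->; apply dab; simpl; auto.
  + intros ->; apply dab; simpl; auto.
  + intros z [<-|hz]; right; [auto|now apply NNPP, all].
(* At the first vertex [z] whose cell misses an end, a cell walk takes over. To end in [a] or [b] it
   would have to pass through [pa] or [pb], whose cells contain both ends; then so would
   [cell z]. *)
- assert (hz : ~ X z) by (apply hs2; rewrite e; apply in_or_app; simpl; auto).
  assert (hl1 : forall y, In y l1 -> In y s2) by (intros; rewrite e; apply in_or_app; auto).
  assert (h1' : forall y, In y l1 -> cell y a /\ cell y b) by (intros; now apply NNPP, h1).
  destruct (cell_walk z z hz) as [q [d' [wq [ndq [hq [hd' [cq [cd _]]]]]]]].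
  assert (cq' : forall y, In y (z :: q) -> cell z y).
  { intros y [<-|hy]; auto; now apply cell_refl with c. }
  assert (dis : forall y, In y (z :: q) -> cell y a /\ cell y b -> False).
  { intros y hy [y1 y2]; apply nz; split; apply (cell_incl X L z y); auto. }
  assert (hzq : forall y, In y (z :: q) -> ~ X y) by (intros y [<-|hy]; auto).
  rewrite e in wx; apply walk_app in wx; destruct wx as [w1 _].
  destruct (exists_last ne) as [l' [pb e']].
  assert (hpb : In pb l) by (rewrite e'; apply in_or_app; simpl; auto).
  assert (hpa : exists pa, In pa l /\ G a pa).
  { destruct l as [|pa l0]; [tauto|exists pa; split; [now left|apply w]]. }
  destruct hpa as [pa [hpa ga]].
  assert (gb : G b pb).
  { rewrite e' in w; apply walk_app in w; now apply Gsym. }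
  exists x, (l1 ++ z :: q), d'; splits; auto.
  + now apply walk_app.
  + intros ->; apply (dis pa); auto; apply (last_outside z q a); auto.
  + intros ->; apply (dis pb); auto; apply (last_outside z q b); auto.
  + apply NoDup_app; eauto.
    rewrite e in nd2; now apply NoDup_app_remove_r in nd2.
  + intros y hy; apply in_app_or in hy; destruct hy as [hy|hy]; split; auto.
    intros hy'; apply (dis y); auto.
  + intros y [<-|hy]; [right; auto|].
    apply in_app_or in hy; destruct hy as [hy|hy]; auto.
Qed.

End Stage.

(** * Absorbing a vertex *)

Definition upd (f : V -> bool) z k y := if excluded_middle_informative (y = z) then k else f y.

Lemma upd_eq f z k : upd f z k z = k.
Proof. unfold upd; destruct excluded_middle_informative; tauto. Qed.

Lemma upd_neq f z k y : y <> z -> upd f z k y = f y.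
Proof. unfold upd; destruct excluded_middle_informative; tauto. Qed.

Definition bichrom (f : V -> bool) x y := G x y /\ f x <> f y.

Lemma bichrom_sym f x y : bichrom f x y -> bichrom f y x.
Proof. unfold bichrom; intuition. Qed.

(* [k] is the colour that [x] needs once the colour of the end [e] is given. *)
Lemma leg_colour l : forall x e g, walk V G x l e -> NoDup l -> ~ In e l ->
  exists f k, (forall y, ~ In y l -> f y = g y) /\
    forall h, (forall y, In y l \/ y = e -> h y = f y) -> h x = k ->
    walk V (bichrom h) x l e.
Proof.
induction l as [|z l IH]; intros x e g w nd he.
- exists g, (negb (g e)); split; auto; intros h hh hx; split; auto.
  rewrite (hh e), hx; auto; now destruct (g e).
- destruct w as [w1 w2]; inversion nd as [|? ? nz nd']; subst.
  destruct (IH z e g w2 nd') as [f [k [h1 h2]]]; [intros h; apply he; now right|].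
  exists (upd f z k), (negb k); split.
  + intros y hy; rewrite upd_neq; [apply h1|]; intros h; apply hy; simpl; auto.
  + intros h hh hx.
    assert (hz : h z = k) by (rewrite (hh z); [apply upd_eq|simpl; auto]).
    split; [split; auto; rewrite hx, hz; now destruct k|].
    apply h2; auto; intros y hy; rewrite hh; simpl; [|tauto].
    apply upd_neq; intros ->; destruct hy as [hy|hy]; [tauto|].
    apply he; simpl; auto.
Qed.

(* Two of the three colours that the legs want at [x] agree. *)
Lemma tripod x l1 e1 l2 e2 l3 e3 (g : V -> bool) :
  walk V G x l1 e1 -> walk V G x l2 e2 -> walk V G x l3 e3 ->
  NoDup (x :: l1 ++ l2 ++ l3) ->
  (forall e, e = e1 \/ e = e2 \/ e = e3 -> ~ In e (x :: l1 ++ l2 ++ l3)) ->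
  exists h, (forall y, ~ In y (x :: l1 ++ l2 ++ l3) -> h y = g y) /\
    (walk V (bichrom h) x l1 e1 /\ walk V (bichrom h) x l2 e2 \/
     walk V (bichrom h) x l1 e1 /\ walk V (bichrom h) x l3 e3 \/
     walk V (bichrom h) x l2 e2 /\ walk V (bichrom h) x l3 e3).
Proof.
intros w1 w2 w3 nd he.
inversion nd as [|? ? nx nd']; subst; clear nd.
assert (nd1 := NoDup_app_remove_r _ _ nd'); assert (nd23 := NoDup_app_remove_l _ _ nd').
assert (nd2 := NoDup_app_remove_r _ _ nd23); assert (nd3 := NoDup_app_remove_l _ _ nd23).
assert (d1 : forall y, In y l1 -> In y (l2 ++ l3) -> False).
{ intros y; apply NoDup_app_disj; auto. }
assert (d2 : forall y, In y l2 -> In y l3 -> False).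
{ intros y; apply NoDup_app_disj; auto. }
assert (he' : forall e, e = e1 \/ e = e2 \/ e = e3 ->
  e <> x /\ ~ In e l1 /\ ~ In e l2 /\ ~ In e l3).
{ intros e h; specialize (he e h); simpl in he; rewrite !in_app_iff in he; intuition. }
rewrite !in_app_iff in nx.
destruct (leg_colour l1 x e1 g w1 nd1) as [f1 [k1 [a1 b1]]]; [now apply he'; auto|].
destruct (leg_colour l2 x e2 f1 w2 nd2) as [f2 [k2 [a2 b2]]]; [now apply he'; auto|].
destruct (leg_colour l3 x e3 f2 w3 nd3) as [f3 [k3 [a3 b3]]]; [now apply he'; auto|].
assert (K : forall k, (k = k1 -> walk V (bichrom (upd f3 x k)) x l1 e1) /\
  (k = k2 -> walk V (bichrom (upd f3 x k)) x l2 e2) /\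
  (k = k3 -> walk V (bichrom (upd f3 x k)) x l3 e3)).
{ intros k; splits; intros ->.
  - apply b1; [|apply upd_eq]; intros y hy.
    assert (~ In y (l2 ++ l3) /\ y <> x).
    { destruct hy as [hy| ->].
      - split; [intros h; apply (d1 y); auto|intros ->; tauto].
      - rewrite in_app_iff; destruct (he' e1); tauto. }
    rewrite in_app_iff in H; rewrite upd_neq, a3, a2; tauto.
  - apply b2; [|apply upd_eq]; intros y hy.
    assert (~ In y l3 /\ y <> x).
    { destruct hy as [hy| ->].
      - split; [intros h; apply (d2 y); auto|intros ->; tauto].
      - destruct (he' e2); tauto. }
    rewrite upd_neq, a3; tauto.
  - apply b3; [|apply upd_eq]; intros y hy; apply upd_neq.
    destruct hy as [hy| ->]; [intros ->; tauto|destruct (he' e3); tauto]. }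
assert (A : forall k y, ~ In y (x :: l1 ++ l2 ++ l3) -> upd f3 x k y = g y).
{ intros k y hy; simpl in hy; rewrite !in_app_iff in hy.
  rewrite upd_neq, a3, a2, a1; auto; intuition. }
destruct (Bool.bool_dec k1 k2) as [e|n12].
{ exists (upd f3 x k1); split; [apply A|left; split; apply K; auto]. }
destruct (Bool.bool_dec k1 k3) as [e|n13].
{ exists (upd f3 x k1); split; [apply A|right; left; split; apply K; auto]. }
exists (upd f3 x k2); split; [apply A|right; right; split; apply K; auto].
destruct k1, k2, k3; congruence.
Qed.

Lemma walk_legs (R : V -> V -> Prop) x l1 a l2 b : (forall u v, R u v -> R v u) ->
  walk V R x l1 a -> walk V R x l2 b -> walk V R a (rev l1 ++ x :: l2) b.
Proof. intros Rs w1 w2; apply walk_app; split; auto; now apply walk_rev. Qed.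

(** The deleted vertex [s] lies on at most one side of [x]. The ends may coincide, so that a cycle
    closed at [a] is covered as well as an ear. *)
Lemma walk_escape (R : V -> V -> Prop) a l b x s : (forall u v, R u v -> R v u) ->
  walk V R a l b -> NoDup l -> ~ In a l -> ~ In b l -> In x l -> x <> s ->
  (a = b -> a <> s) ->
  exists y, (y = a \/ y = b) /\ y <> s /\
    rt (fun u v => R u v /\ (In u (a :: l ++ [b]) /\ u <> s) /\
      (In v (a :: l ++ [b]) /\ v <> s)) x y.
Proof.
intros Rs w nd na nb hx xs ab; destruct (in_split _ _ hx) as [l1 [l2 ->]].
apply walk_app in w; destruct w as [w1 w2].
rewrite !in_app_iff in *; simpl in *.
destruct (classic (In s (a :: l1))) as [h|h].
- assert (bs : b <> s).
  { intros ->; destruct h as [->|h]; [now apply ab|tauto]. }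
  exists b; splits; auto.
  apply (walk_rt V R x l2 b); auto; [|now left|right; apply in_or_app; simpl; auto].
  intros z hz; split.
  + right; rewrite !in_app_iff; simpl in *; rewrite in_app_iff in hz; simpl in hz; tauto.
  + intros ->; assert (hz' : In s (x :: l2)).
    { destruct hz as [hz|hz]; [now left|]; apply in_app_or in hz.
      destruct hz as [hz|[hz|[]]]; [now right|congruence]. }
    destruct h as [<-|h]; [simpl in hz'; tauto|].
    now apply (NoDup_app_disj _ _ _ s nd).
- exists a; splits; auto.
  + intros ->; apply h; now left.
  + apply rt_sym; [intros u v; intuition|].
    apply (walk_rt V R a l1 x); auto; [|now left|right; apply in_or_app; simpl; auto].
    intros z hz; split.
    * simpl in *; rewrite !in_app_iff in *; simpl in *; tauto.
    * intros ->; simpl in *; rewrite in_app_iff in hz; simpl in hz; intuition.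
Qed.

Lemma bichrom_hst (P X : V -> Prop) f S : (forall z, P z -> X z /\ ~ S z) -> forall x y,
  rt (fun u v => bichrom f u v /\ P u /\ P v) x y -> rt (hst X f S) x y.
Proof.
intros h; apply rt_mono; intros u v [[g n] [hu hv]].
destruct (h u hu), (h v hv); splits; auto; repeat split; auto.
Qed.

Section Stage.
Variables (X : V -> Prop) (c : V -> bool) (L : list (V -> Prop)).
Hypothesis st : stage X c L.

(** 2-connectivity survives because each ear vertex escapes to an end. For [stage_peq], the interior
    of the ear avoids all levels and is connected, so only its link to the old part matters. *)
Lemma add_ear a l b f : hpath X L a l b -> (forall y, X y -> f y = c y) ->
  walk V (bichrom f) a l b -> stage (fun x => X x \/ In x l) f L.
Proof.
intros [ha [hb [nab [w [nd [hl [ne hc]]]]]]] hf wf.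
set (X' := fun x => X x \/ In x l).
assert (XX : forall S x y, rt (hst X c S) x y -> rt (hst X' f S) x y).
{ intros S; apply hst_extend; unfold X'; auto. }
assert (esc : forall s x, X' x -> x <> s ->
  exists y, X y /\ y <> s /\ rt (hst X' f (eq s)) x y).
{ intros s x [hx|hx] n; [exists x; splits; auto; apply rt_refl|].
  destruct (walk_escape (bichrom f) a l b x s) as [y [hy [ys r]]]; auto.
  - apply bichrom_sym.
  - intros h; now apply (hl a).
  - intros h; now apply (hl b).
  - exists y; splits; auto; [destruct hy; subst; auto|].
    eapply (bichrom_hst _ X' f (eq s)); [|exact r].
    simpl; intros z [[<-|hz] nz]; split; unfold X'; auto.
    apply in_app_or in hz; destruct hz as [hz|[<-|[]]]; auto. }
destruct st as [s1 s2 s3 s4 s5 s6 s7]; constructor; auto.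
- destruct s1 as [m hm]; exists (m ++ l); intros x [hx|hx]; apply in_or_app; auto.
- destruct s2 as [x [y [z H]]]; exists x, y, z; unfold X'; tauto.
- intros s x y hx hy xs ys.
  destruct (esc s x hx xs) as [x' [hx' [xs' rx]]], (esc s y hy ys) as [y' [hy' [ys' ry]]].
  apply rt_trans with x'; auto; apply rt_trans with y'; auto.
  apply rt_sym; auto; apply hst_sym.
- intros S hS x hx; left; eauto.
- intros S hS x y hx hy p.
  assert (LL : forall x y, In x l -> In y l -> rt (hst X' f S) x y).
  { intros u v hu hv; eapply (bichrom_hst (fun z => In z l)).
    - intros z hz; split; [now right|intros h; apply (hl z); eauto].
    - apply (walk_inner_rt _ a l b); auto; apply bichrom_sym. }
  assert (LE : forall x e, In x l -> e = a \/ e = b -> ~ S e -> rt (hst X' f S) x e).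
  { intros u e hu he ne'.
    assert (E : exists q, In q l /\ bichrom f q e).
    { destruct he as [-> | ->].
      - destruct l as [|q l0]; [tauto|]; exists q; split; [now left|].
        apply bichrom_sym, wf.
      - destruct (exists_last ne) as [l' [q e']]; rewrite e' in *; exists q; split.
        + apply in_or_app; simpl; auto.
        + apply walk_app in wf; apply wf. }
    destruct E as [q [hq [g nq]]]; apply rt_trans with q; auto.
    apply rt_step; repeat split; auto; [now right|left; destruct he; subst; auto|].
    intros h; apply (hl q); eauto. }
  (* The old vertex [v] shows that [u] touches the level, so the cell condition puts an end of the
     ear into their class; from there the old stage connects to [v]. *)
  assert (LX : forall x y, In x l -> X y -> peq S x y -> rt (hst X' f S) x y).
  { intros u v hu hv q.
    assert (t : touched X u S) by (exists v; auto).
    assert (E : exists e, (e = a \/ e = b) /\ X e /\ peq S u e).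
    { destruct (hc u hu) as [h|h]; [exists a|exists b]; splits; auto; apply h; auto. }
    destruct E as [e [he [hXe pe]]]; apply rt_trans with e.
    - apply LE; auto; apply pe.
    - apply XX, s7; auto; apply peq_trans with u; auto; now apply peq_sym. }
  destruct hx as [hx|hx], hy as [hy|hy]; auto.
  apply rt_sym; [apply hst_sym|]; apply LX; auto; now apply peq_sym.
Qed.

End Stage.

Lemma walk_tail_rt (R : V -> V -> Prop) a l y : (forall u v, R u v -> R v u) ->
  walk V R a l y -> forall u v, In u (l ++ [y]) -> In v (l ++ [y]) ->
  rt (fun p q => R p q /\ In p (l ++ [y]) /\ In q (l ++ [y])) u v.
Proof.
intros Rs w; destruct l as [|q l].
- intros u v [<-|[]] [<-|[]]; apply rt_refl.
- destruct w as [_ w]; intros u v hu hv; apply (walk_rt V R q l y); auto.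
Qed.

(** A vertex before [x] that relied on [b] has [x] in its cell by convexity, and [x] in turn has [d]
    or [a] in its own. *)
Lemma leg_hpath X c L a la x lb b r d : stage X c L ->
  hpath X L a (rev la ++ x :: lb) b -> walk V G x r d -> X d -> d <> a -> NoDup r ->
  (forall z, In z r -> ~ X z /\ ~ In z (rev la ++ x :: lb)) ->
  (forall z, In z (x :: r) -> cell X L z d \/ cell X L z a /\ cell X L z b) ->
  hpath X L a (rev la ++ x :: r) d.
Proof.
intros st [ha [hb [nab [w [nd [hl [ne hc]]]]]]] wr hd da ndr hr cr.
apply walk_app in w; destruct w as [w1 w2].
assert (inl : forall z, In z (rev la) -> In z (rev la ++ x :: lb)).
{ intros; apply in_or_app; auto. }
assert (inx : In x (rev la ++ x :: lb)) by (apply in_or_app; simpl; auto).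
unfold hpath; splits; auto.
- now apply walk_app.
- apply NoDup_app.
  + now apply NoDup_app_remove_r in nd.
  + constructor; auto; intros h; now apply (hr x).
  + intros z hz [<-|hz'].
    * apply NoDup_remove_2 in nd; apply nd, in_or_app; auto.
    * now apply (hr z hz'), inl.
- intros z hz; apply in_app_or in hz; destruct hz as [hz|[<-|hz]]; auto; now apply hr.
- intros e; apply app_eq_nil in e; destruct e; discriminate.
- intros z hz; apply in_app_or in hz; destruct hz as [hz|hz].
  2: { destruct (cr z hz) as [h|[h _]]; auto. }
  destruct (hc z (inl z hz)) as [h|h]; auto.
  assert (zx : cell X L z x).
  { apply (cell_convex X c L st (fun t => In t (rev la ++ [x]))
      (fun t => In t (x :: lb ++ [b])) z x b); auto.
    - intros t ht; apply hl; apply in_app_or in ht; destruct ht as [ht|[<-|[]]]; auto.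
    - intros t [<-|ht] hX; [now destruct (hl x)|].
      apply in_app_or in ht; destruct ht as [ht|[<-|[]]]; auto.
      destruct (hl t); auto; apply in_or_app; simpl; auto.
    - intros t ht ht'; apply in_app_or in ht; destruct ht as [ht|[<-|[]]]; auto.
      destruct ht' as [->|ht']; auto; apply in_app_or in ht'.
      destruct ht' as [ht'|[<-|[]]].
      + destruct (NoDup_app_disj _ _ _ t nd ht); now right.
      + now destruct (hl b); auto.
    - apply in_or_app; simpl; auto.
    - apply (walk_tail_rt G a (rev la) x); auto; apply in_or_app; simpl; auto.
    - apply (walk_rt V G x lb b); auto; [now left|right; apply in_or_app; simpl; auto]. }
  destruct (cr x (or_introl eq_refl)) as [h'|[h' _]];
    [right|left]; apply (cell_incl X L z x); auto.
Qed.

(* [x] separates the rest of the path from the new ear, so by convexity every component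
   that meets both contains [x]. *)
Lemma rest_hpath X X' c f L a la x lb b r d : stage X c L -> stage X' f L ->
  (forall z, X' z <-> X z \/ In z (rev la ++ x :: r)) ->
  hpath X L a (rev la ++ x :: lb) b -> walk V G x r d ->
  (forall z, In z r -> ~ X z /\ ~ In z (rev la ++ x :: lb)) ->
  lb <> [] -> hpath X' L x lb b.
Proof.
intros st st' eX [ha [hb [nab [w [nd [hl [ne hc]]]]]]] wr hr nlb.
apply walk_app in w; destruct w as [w1 w2].
assert (inl : forall z, In z (rev la) -> In z (rev la ++ x :: lb)).
{ intros; apply in_or_app; auto. }
assert (inb : forall z, In z (x :: lb) -> In z (rev la ++ x :: lb)).
{ intros; apply in_or_app; auto. }
assert (ndb := NoDup_app_remove_l _ _ nd); inversion ndb as [|? ? nxb ndb']; subst.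
assert (sep : forall z, In z (x :: lb) -> In z (rev la ++ x :: r) -> z = x).
{ intros z hz hz'; apply in_app_or in hz'; destruct hz' as [hz'|[hz'|hz']]; auto.
  - destruct (NoDup_app_disj _ _ _ z nd hz' hz).
  - destruct (hr z hz') as [_ h]; destruct h; auto. }
assert (hX' : forall z, In z lb -> ~ X' z).
{ intros z hz h; apply eX in h; destruct h as [h|h].
  - apply (hl z); auto; apply inb; now right.
  - apply nxb; rewrite <- (sep z); auto; now right. }
unfold hpath; splits; auto.
- apply eX; right; apply in_or_app; simpl; auto.
- apply eX; auto.
- intros ->; apply (hl b); auto; apply inb; now left.
(* The new cell of [z] is a class at a level [S], which contains some [y] of the enlarged stage. If
   [y] is old, the old cell condition gives [b] directly or a path from [a] through [x]; if [y] is
   on the new ear, that ear leads to [x]. *)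
- intros z hz; destruct (cell_peq X' f L st' z) as [S [hS [[y [hy p]] cS]]].
  assert (nS : forall t, ~ X t -> ~ S t) by (intros t h h'; apply h; eapply stage_sub; eauto).
  assert (wx : forall P : V -> Prop, (forall t, P t -> ~ S t) ->
    (forall t, In t (x :: lb) -> P t -> t = x) ->
    forall y', rt (fun u v => G u v /\ P u /\ P v) x y' -> peq S z y' -> peq S z x).
  { intros P hP hP' y' rP py.
    apply (peq_convex S (fun t => In t (x :: lb)) P z x y'); auto.
    - now left.
    - destruct (exists_last nlb) as [lb' [q e]]; rewrite e in *.
      apply walk_app in w2; destruct w2 as [w2 _].
      apply (walk_rt V G x lb' q); auto; [now right|now left]. }
  assert (old : X y -> cell X' L z x \/ cell X' L z b).
  { intros hy'; assert (t : touched X z S) by (exists y; auto).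
    destruct (hc z) as [h|h]; [apply inb; now right| |].
    - left; apply cS; assert (pa := h S hS t).
      apply (wx (fun t => In t (a :: rev la ++ [x]))) with a; auto.
      + intros u [<-|hu]; [apply pa|apply nS, hl].
        apply in_app_or in hu; destruct hu as [hu|[<-|[]]]; auto; apply inb; now left.
      + intros u hu [<-|hu']; [now destruct (hl a); auto|].
        apply sep; auto; apply in_app_or in hu'; apply in_or_app; simpl in *; tauto.
      + apply (walk_rt V G a (rev la) x); auto; [right; apply in_or_app; simpl; auto|now left].
    - right; apply cS; apply (h S hS t). }
  apply eX in hy; destruct hy as [hy|hy]; auto.
  left; apply cS; apply (wx (fun t => In t (rev la ++ x :: r))) with y; auto.
  + intros t ht; apply nS; apply in_app_or in ht; destruct ht as [ht|[<-|ht]]; auto.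
    * apply hl, inb; now left.
    * now apply hr.
  + apply (walk_inner_rt G a (rev la ++ x :: r) d); auto; [now apply walk_app|].
    apply in_or_app; simpl; auto.
Qed.

Lemma absorb_hpath n : forall X c L, stage X c L -> forall l a b v,
  length l < n -> hpath X L a l b -> In v l ->
  exists X' c', stage X' c' L /\ (forall x, X x -> X' x) /\
    (forall x, X x -> c' x = c x) /\ X' v.
Proof.
induction n as [|n IH]; intros X c L st l a b v hn hP hv; [lia|].
destruct (leg X c L st a l b hP) as [x [r [d [hx [wr [hd [da [db [ndr [hr cr]]]]]]]]]].
destruct (in_split _ _ hx) as [l1 [lb e]].
assert (e1 := rev_involutive l1); revert e1; generalize (rev l1); intros la e1.
rewrite <- e1 in e; clear l1 e1; subst l.
assert (hP' := hP); destruct hP' as [ha [hb [nab [w [nd [hl [ne hc]]]]]]].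
apply walk_app in w; destruct w as [w1 w2].
assert (wa : walk V G x la a).
{ rewrite <- (rev_involutive la); now apply walk_rev. }
assert (mem : forall z, In z (x :: la ++ lb ++ r) <->
  In z (rev la ++ x :: lb) \/ In z r).
{ intros z; simpl; rewrite !in_app_iff, <- in_rev; simpl; tauto. }
assert (out : forall z, In z (x :: la ++ lb ++ r) -> ~ X z).
{ intros z hz; apply mem in hz; destruct hz as [hz|hz]; auto; now apply hr. }
destruct (tripod x la a lb b r d c wa w2 wr) as [h [hh two]].
{ assert (nd' : NoDup (x :: la ++ lb)).
  { apply NoDup_remove in nd; destruct nd as [nd nx]; constructor.
    - rewrite in_app_iff, <- in_rev, <- in_app_iff in nx; exact nx.
    - apply NoDup_app.
      + apply NoDup_rev in nd; rewrite rev_app_distr, rev_involutive in nd.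
        now apply NoDup_app_remove_l in nd.
      + now apply NoDup_app_remove_l in nd.
      + intros z hz hz'; apply (NoDup_app_disj _ _ _ z nd); auto; now apply in_rev in hz. }
  rewrite app_assoc, app_comm_cons; apply NoDup_app; auto.
  intros z hz hz'; apply (hr z hz').
  rewrite in_app_iff, <- in_rev; simpl in *; rewrite in_app_iff in hz; tauto. }
{ intros y [-> | [-> | ->]] hy; now apply out in hy. }
assert (hh' : forall y, X y -> h y = c y).
{ intros y hy; apply hh; intros hy'; now apply (out y). }
(* The case where the new leg [r] is one of the two matching paths. The ends are general so that [a]
   and [b] can be exchanged. *)
assert (FIN : forall a la lb b, hpath X L a (rev la ++ x :: lb) b ->
  length (rev la ++ x :: lb) < S n -> walk V (bichrom h) x la a ->
  walk V (bichrom h) x r d -> d <> a ->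
  (forall z, In z r -> ~ X z /\ ~ In z (rev la ++ x :: lb)) ->
  (forall z, In z (x :: r) -> cell X L z d \/ cell X L z a /\ cell X L z b) ->
  In v (rev la ++ x :: lb) ->
  exists X' c', stage X' c' L /\ (forall x, X x -> X' x) /\
    (forall x, X x -> c' x = c x) /\ X' v).
{ clear a la lb b hn hP hv hr cr hx ha hb nab w1 w2 nd hl ne hc wa mem out hh two da db.
  intros a la lb b hP hn wa wd da hr cr hv.
  assert (hE := leg_hpath X c L a la x lb b r d st hP wr hd da ndr hr cr).
  assert (st' := add_ear X c L st a _ d h hE hh'
    (walk_legs _ _ _ _ _ _ (bichrom_sym h) wa wd)).
  apply in_app_or in hv; destruct (classic (In v (rev la ++ x :: r))) as [hv'|nv].
  - eexists _, h; splits; [exact st'| |auto|]; simpl; auto.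
  - assert (hvb : In v lb).
    { rewrite in_app_iff in nv; simpl in *; tauto. }
    assert (hR : hpath (fun z => X z \/ In z (rev la ++ x :: r)) L x lb b).
    { eapply (rest_hpath X _ c h L a la x lb b r d); eauto; [simpl; tauto|].
      intros ->; destruct hvb. }
    destruct (IH _ h L st' lb x b v) as [X2 [c2 [st2 [i2 [a2 v2]]]]]; auto.
    { rewrite length_app in hn; simpl in hn; lia. }
    exists X2, c2; splits; auto; intros y hy; rewrite a2; auto. }
assert (er : rev lb ++ x :: la = rev (rev la ++ x :: lb)).
{ rewrite rev_app_distr; simpl; rewrite rev_involutive, <- app_assoc; reflexivity. }
destruct two as [[t1 t2]|[[t1 t2]|[t1 t2]]].
- eexists _, h; splits.
  + apply (add_ear X c L st a _ b h hP); auto.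
    apply walk_legs; auto; apply bichrom_sym.
  + simpl; auto.
  + auto.
  + simpl; auto.
- apply (FIN a la lb b); auto.
- apply (FIN b lb la a); auto; rewrite ?er.
  + now apply hpath_rev.
  + now rewrite length_rev.
  + intros z hz; rewrite <- in_rev; auto.
  + intros z hz; destruct (cr z hz) as [h'|[h1 h2]]; auto.
  + now apply -> in_rev.
Qed.

Lemma G_rt x y : rt G x y.
Proof.
eapply rt_mono; [|apply (conn_minus [])]; simpl; auto; try lia.
now intros a b [g _].
Qed.

Lemma absorb X c L w : stage X c L -> exists X' c', stage X' c' L /\
  (forall x, X x -> X' x) /\ (forall x, X x -> c' x = c x) /\ X' w.
Proof.
intros st; destruct (stage_three _ _ _ st) as [x0 [_ [_ [h0 _]]]].
assert (r := G_rt x0 w); apply clos_rt_rtn1 in r; induction r as [|y z g _ IH].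
- exists X, c; auto.
- destruct IH as [X1 [c1 [st1 [i1 [a1 hy]]]]].
  destruct (classic (X1 z)) as [hz|hz]; [exists X1, c1; auto|].
  destruct (hpath_start X1 c1 L st1 y z hy hz g) as [l [b hP]].
  destruct (absorb_hpath (S (length (z :: l))) X1 c1 L st1 (z :: l) y b z)
    as [X2 [c2 [st2 [i2 [a2 h2]]]]]; simpl; auto.
  exists X2, c2; splits; auto; intros x hx; rewrite a2; auto.
Qed.

Lemma absorb_list ws : forall X c L, stage X c L -> exists X' c', stage X' c' L /\
  (forall x, X x -> X' x) /\ (forall x, X x -> c' x = c x) /\ forall w, In w ws -> X' w.
Proof.
induction ws as [|w ws IH]; intros X c L st; [exists X, c; simpl; splits; auto; tauto|].
destruct (absorb X c L w st) as [X1 [c1 [st1 [i1 [a1 h1]]]]].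
destruct (IH X1 c1 L st1) as [X2 [c2 [st2 [i2 [a2 h2]]]]].
exists X2, c2; splits; auto.
- intros x hx; rewrite a2; auto.
- intros z [<-|hz]; auto.
Qed.

(** The new level contains all others, and its [stage_peq] condition is vacuous: no vertex of [X]
    lies outside [X]. *)
Lemma stage_push X c L : stage X c L -> stage X c (X :: L).
Proof.
intros [s1 s2 s3 s4 s5 s6 s7]; constructor; auto.
- intros S [<-|h]; eauto.
- intros S S' [<-|h] [<-|h']; eauto.
- now right.
- intros S [<-|h] x y hx hy p; [now destruct p|auto].
Qed.

(** * The initial even cycle *)

Lemma cycle_stage v m h p q : walk V (bichrom h) v m v -> NoDup m -> ~ In v m ->
  In p m -> In q m -> p <> q -> stage (fun z => z = v \/ In z m) h [fun _ => False].
Proof.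
intros w nd nv hp hq pq.
set (X := fun z => z = v \/ In z m).
assert (mem : forall z, In z (v :: m ++ [v]) <-> X z).
{ intros z; unfold X; simpl; rewrite in_app_iff; simpl; intuition. }
constructor.
- exists (v :: m); intros x [->|hx]; simpl; auto.
- exists v, p, q; splits; unfold X; auto; intros ->; tauto.
- intros s x y hx hy xs ys; destruct (classic (v = s)) as [<-|n].
  + apply (bichrom_hst (fun z => In z m)).
    * intros z hz; split; [now right|congruence].
    * apply (walk_inner_rt _ v m v); auto; [apply bichrom_sym| |].
      -- destruct hx; tauto.
      -- destruct hy; tauto.
  + assert (E : forall x, X x -> x <> s -> rt (hst X h (eq s)) x v).
    { intros u [->|hu] us; [apply rt_refl|].
      destruct (walk_escape (bichrom h) v m v u s) as [e [he [es r]]]; auto.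
      - apply bichrom_sym.
      - assert (e = v) by tauto; subst e.
        eapply (bichrom_hst _ X h (eq s)); [|exact r].
        intros z [hz nz]; split; [now apply mem|congruence]. }
    apply rt_trans with v; auto; apply rt_sym; auto; apply hst_sym.
- intros S [<-|[]]; tauto.
- intros S S' [<-|[]] [<-|[]]; auto.
- now left.
- intros S [<-|[]] x y hx hy _; apply (bichrom_hst X); [auto|].
  apply (walk_rt V (bichrom h) v m v); try now apply mem.
  + apply bichrom_sym.
  + exact w.
Qed.

(** A cycle through [v] and its neighbours [n1], [n2], together with a path from it through [n3]
    back to [v], gives three paths from some [x] to [v]. Two of them have equal parity and form an
    even cycle. *)
Lemma stage_exists : exists X c, stage X c [fun _ => False].
Proof.
destruct Gconn as [[l0 [_ hl0]] _]; destruct l0 as [|v l0]; [simpl in hl0; lia|clear l0 hl0].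
destruct (Gcub v) as [n1 [n2 [n3 [g1 [g2 [g3 [n12 [n13 [n23 _]]]]]]]]].
assert (nv : forall n, G v n -> ~ In n [v]).
{ intros n g [<-|[]]; exact (Girr _ g). }
assert (sub : forall x l y, walk V (fun a b => G a b /\ ~ In a [v] /\ ~ In b [v]) x l y ->
  walk V G x l y /\ forall z, In z (x :: l ++ [y]) -> z <> v).
{ intros x l y w; split.
  - eapply walk_mono; [|exact w]; intros a b _ _ [g _]; exact g.
  - intros z hz ->; destruct (walk_ends _ _ _ _ w v hz) as [u [h|h]]; simpl in h; tauto. }
destruct (rt_walk V _ (eq n2) n1 n2 (conn_minus [v] (le_n_S _ _ (le_n_S _ _ (Nat.le_0_l _))) n1 n2 (nv _ g1) (nv _ g2)))
  as [s [e [ws [<- [hs nds]]]]]; auto.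
apply sub in ws; destruct ws as [ws vs].
remember (n1 :: s ++ [n2]) as l eqn:el.
assert (ndl : NoDup l).
{ rewrite el, app_comm_cons; apply NoDup_app; auto.
  - constructor; [tauto|constructor].
  - intros t [<-|ht] [<-|[]]; [auto|now apply (hs n2)]. }
assert (wl : walk V G v l v).
{ rewrite el; split; auto; apply walk_app; split; simpl; auto. }
(* If [n3] is already on the cycle, the third path is the chord from [n3] to [v], with no inner
   vertices. *)
assert (leg3 : exists x r, In x l /\ walk V G x r v /\ NoDup r /\
  (forall z, In z r -> ~ In z l /\ z <> v) /\ In n3 (x :: r)).
{ destruct (classic (In n3 l)) as [h3|h3].
  - exists n3, []; simpl; splits; auto; try constructor; tauto.
  - assert (h1 : In n1 l) by (rewrite el; now left).
    destruct (rt_walk V _ (fun z => In z l) n3 n1 (conn_minus [v] (le_n_S _ _ (le_n_S _ _ (Nat.le_0_l _))) n3 n1 (nv _ g3) (nv _ g1)))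
      as [s' [x [ws' [hx [hs' nds']]]]]; auto.
    apply sub in ws'; destruct ws' as [ws' vs'].
    exists x, (rev s' ++ [n3]); splits; auto.
    + apply walk_app; split; simpl; auto; now apply walk_rev.
    + apply NoDup_rev in nds'; exact nds'.
    + intros z hz; apply in_app_or in hz; rewrite <- in_rev in hz.
      destruct hz as [hz|[<-|[]]]; split; auto; apply vs'; simpl; auto.
      right; apply in_or_app; auto.
    + right; apply in_or_app; simpl; auto. }
destruct leg3 as [x [r [hx [wr [ndr [hr h3]]]]]].
destruct (in_split _ _ hx) as [l1 [l2 e]].
assert (h1 : In n1 (l1 ++ [x])).
{ rewrite e in el; destruct l1; injection el; intros; subst; simpl; auto. }
assert (h2 : In n2 (x :: l2)).
{ rewrite e in el; destruct l2 as [|q l2 _] using rev_ind.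
  - rewrite app_comm_cons in el; apply app_inj_tail in el; left; tauto.
  - rewrite app_comm_cons, app_assoc, app_comm_cons in el.
    apply app_inj_tail in el; right; apply in_or_app; simpl; tauto. }
assert (vl : ~ In v l) by (intros h; now apply (vs v)).
rewrite e in ndl, wl, vl; assert (hr' : forall z, In z r -> ~ In z (l1 ++ x :: l2) /\ z <> v).
{ rewrite <- e; exact hr. }
clear hr hx el e vs l; apply walk_app in wl; destruct wl as [w1 w2].
destruct (tripod x (rev l1) v l2 v r v (fun _ => true)) as [h [_ two]]; auto.
{ now apply walk_rev. }
{ assert (nd' := ndl); apply NoDup_remove in nd'; destruct nd' as [nd' nx].
  rewrite app_assoc, app_comm_cons; apply NoDup_app; auto.
  - constructor.
    + rewrite in_app_iff, <- in_rev, <- in_app_iff; exact nx.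
    + apply NoDup_app.
      * apply NoDup_rev; now apply NoDup_app_remove_r in nd'.
      * now apply NoDup_app_remove_l in nd'.
      * intros z hz hz'; apply (NoDup_app_disj _ _ _ z nd'); auto; now apply in_rev in hz.
  - intros z hz hz'; apply (proj1 (hr' z hz')).
    simpl in hz; rewrite in_app_iff, <- in_rev in hz; rewrite in_app_iff; simpl; tauto. }
{ intros u hu; assert (u = v) as -> by (destruct hu as [h|[h|h]]; exact h); simpl; rewrite !in_app_iff, <- in_rev.
  rewrite in_app_iff in vl; simpl in vl; intros h.
  assert (~ In v r) by (intros h'; now apply (hr' v)); tauto. }
(* The two neighbours of [v] on the chosen paths serve as [p] and [q], the further vertices that
   make the cycle large enough for a stage. *)
assert (FIN : forall la lb p q, walk V (bichrom h) x la v -> walk V (bichrom h) x lb v ->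
  NoDup (rev la ++ x :: lb) -> ~ In v (rev la ++ x :: lb) ->
  In p (rev la ++ [x]) -> In q (x :: lb) -> p <> q ->
  exists X c, stage X c [fun _ => False]).
{ intros la lb p q wa wb nd nv' hp hq pq; eexists _, h.
  apply (cycle_stage v (rev la ++ x :: lb) h p q); auto.
  - apply walk_legs; auto; apply bichrom_sym.
  - apply in_app_or in hp; apply in_or_app; simpl in *; tauto.
  - apply in_or_app; auto. }
assert (ndx : NoDup (x :: r)).
{ constructor; auto; intros hx; apply (proj1 (hr' x hx)); apply in_or_app; simpl; auto. }
assert (vr : ~ In v r) by (intros hx; now apply (hr' v)).
rewrite in_app_iff in vl; simpl in vl.
destruct two as [[t1 t2]|[[t1 t2]|[t1 t2]]].
- apply (FIN (rev l1) l2 n1 n2); auto; rewrite rev_involutive; auto.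
  rewrite in_app_iff; simpl; tauto.
- apply (FIN (rev l1) r n1 n3); auto; rewrite rev_involutive; auto.
  + apply NoDup_app; auto; [now apply NoDup_app_remove_r in ndl|].
    intros z hz [<-|hz']; [apply NoDup_remove_2 in ndl; apply ndl, in_or_app; auto|].
    apply (proj1 (hr' z hz')), in_or_app; auto.
  + rewrite in_app_iff; simpl; tauto.
- apply (FIN l2 r n2 n3); auto.
  + apply NoDup_app_remove_l in ndl; inversion ndl; subst.
    apply NoDup_app; auto; [now apply NoDup_rev|].
    intros z hz; rewrite <- in_rev in hz; intros [<-|hz']; [tauto|].
    apply (proj1 (hr' z hz')), in_or_app; simpl; auto.
  + rewrite in_app_iff, <- in_rev; simpl; tauto.
  + rewrite in_app_iff, <- in_rev; simpl in *; tauto.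
Qed.

(** * The limit *)

Definition state : Type :=
  {p : (V -> Prop) * (V -> bool) * list (V -> Prop) | stage (fst (fst p)) (snd (fst p)) (snd p)}.

Definition st_set (p : state) : V -> Prop := fst (fst (proj1_sig p)).
Definition st_col (p : state) : V -> bool := snd (fst (proj1_sig p)).
Definition st_lev (p : state) : list (V -> Prop) := snd (proj1_sig p).

(** Absorbing all neighbours makes the stages exhaust the connected graph [G]; recording the old set
    as a level controls all later growth outside it. *)
Definition step (p q : state) : Prop :=
  (forall x, st_set p x -> st_set q x) /\
  (forall x, st_set p x -> st_col q x = st_col p x) /\
  (forall x y, st_set p x -> G x y -> st_set q y) /\
  incl (st_lev p) (st_lev q) /\ In (st_set p) (st_lev q).

Lemma step_exists p : exists q, step p q.
Proof.
destruct p as [[[X c] L] st]; simpl in st.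
destruct (stage_fin _ _ _ st) as [M hM], (finite_nbrs M) as [N hN].
destruct (absorb_list N X c (X :: L) (stage_push X c L st)) as [X' [c' [st' [i [a h]]]]].
exists (exist _ (X', c', X :: L) st'); unfold step, st_set, st_col, st_lev; simpl; splits; auto.
- intros x y hx g; apply h; eauto.
- intros S hS; now right.
Qed.

Lemma stages : exists s : nat -> state, forall n, step (s n) (s (S n)).
Proof.
destruct stage_exists as [X [c st]].
pose (next := fun p => proj1_sig (constructive_indefinite_description _ (step_exists p))).
exists (fun n => Nat.iter n next (exist _ (X, c, [fun _ => False]) st)).
intros n; simpl; unfold next.
exact (proj2_sig (constructive_indefinite_description _ (step_exists _))).
Qed.

(** The first property yields 2-connectivity of the limit, the second faithfulness. For the latter,
    [N] lists a stage containing [M]; since it is a level from then on, [stage_peq] of a late stage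
    applies. *)
Lemma bipartite_skeleton : exists C : V -> bool,
  (forall s x y, x <> s -> y <> s ->
    rt (fun a b => bichrom C a b /\ a <> s /\ b <> s) x y) /\
  (forall M : list V, exists N : list V, incl M N /\ forall x y, peq (fun z => In z N) x y ->
    rt (fun a b => bichrom C a b /\ ~ In a N /\ ~ In b N) x y).
Proof.
destruct stages as [s hs].
assert (st : forall n, stage (st_set (s n)) (st_col (s n)) (st_lev (s n))).
{ intros n; exact (proj2_sig (s n)). }
assert (mono : forall m n, m <= n -> (forall x, st_set (s m) x ->
  st_set (s n) x /\ st_col (s n) x = st_col (s m) x) /\ incl (st_lev (s m)) (st_lev (s n))).
{ intros m n h; induction h as [|n h [IH1 IH2]]; [split; auto; apply incl_refl|].
  destruct (hs n) as [i [a [_ [iL _]]]]; split.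
  - intros x hx; destruct (IH1 x hx); split; auto; rewrite a; auto.
  - intros S hS; auto. }
assert (cov : forall v, exists n, st_set (s n) v).
{ intros v; destruct (stage_three _ _ _ (st 0)) as [x0 [_ [_ [h0 _]]]].
  assert (r := G_rt x0 v); apply clos_rt_rtn1 in r; induction r as [|y z g _ [n IH]].
  - now exists 0.
  - exists (S n); destruct (hs n) as [_ [_ [h _]]]; eauto. }
(* Any stage containing [v] gives the same colour, because later stages keep it. *)
pose (rank := fun v => proj1_sig (constructive_indefinite_description _ (cov v))).
pose (C := fun v => st_col (s (rank v)) v).
assert (rk : forall v, st_set (s (rank v)) v).
{ intros v; exact (proj2_sig (constructive_indefinite_description _ (cov v))). }
assert (hC : forall n v, st_set (s n) v -> C v = st_col (s n) v).
{ intros n v h; unfold C.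
  destruct (mono (rank v) (max (rank v) n)) as [h1 _]; [lia|].
  destruct (mono n (max (rank v) n)) as [h2 _]; [lia|].
  destruct (h1 v (rk v)) as [_ <-]; destruct (h2 v h) as [_ <-]; reflexivity. }
assert (big : forall M : list V, exists n, forall x, In x M -> st_set (s n) x).
{ induction M as [|v M [n IH]]; [exists 0; intros x []|].
  exists (max (rank v) n); intros x [<-|h].
  - apply (mono (rank v)); [lia|auto].
  - apply (mono n); [lia|auto]. }
assert (lift : forall n S x y, rt (hst (st_set (s n)) (st_col (s n)) S) x y ->
  rt (fun a b => bichrom C a b /\ ~ S a /\ ~ S b) x y).
{ intros n S; apply rt_mono; intros a b [g [h [ha [hb h']]]].
  repeat split; try tauto; now rewrite (hC n a ha), (hC n b hb). }
exists C; split.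
- intros t x y xt yt; destruct (big [x; y]) as [n hn].
  eapply rt_mono; [|apply (lift n (eq t))].
  + intros a b [h [ha hb]]; auto.
  + apply (stage_conn _ _ _ (st n)); auto; apply hn; simpl; auto.
- intros M; destruct (big M) as [n hn], (stage_fin _ _ _ (st n)) as [N0 hN0].
  pose (N := filter (fun x => if excluded_middle_informative (st_set (s n) x) then true else false) N0).
  assert (hN : forall x, In x N <-> st_set (s n) x).
  { intros x; unfold N; rewrite filter_In; destruct excluded_middle_informative; intuition.
    discriminate. }
  exists N; split; [intros x hx; apply hN; auto|intros x y p].
  destruct (big [x; y]) as [m hm].
  (* Beyond [n], so that stage [n] is a level of stage [k], and beyond [m], so that stage [k]
     contains [x] and [y]. *)
  pose (k := S (max n m)).
  assert (p' : peq (st_set (s n)) x y).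
  { eapply peq_anti; [|exact p]; intros z hz; now apply hN. }
  eapply rt_mono; [|apply (lift k (st_set (s n)))].
  + intros a b; rewrite !hN; auto.
  + apply (stage_peq _ _ _ (st k)); auto.
    * destruct (mono (S n) k) as [_ h]; [unfold k; lia|]; apply h.
      destruct (hs n) as [_ [_ [_ [_ h']]]]; exact h'.
    * apply (mono m); [unfold k; lia|apply hm; simpl; auto].
    * apply (mono m); [unfold k; lia|apply hm; simpl; auto].
Qed.

(** * Rays and bridges *)

Lemma ray_avoids R (r : nat -> V) (M : list V) : ray V R r ->
  exists n, forall k, n <= k -> ~ In (r k) M.
Proof.
intros [inj _]; induction M as [|x M [n IH]]; [exists 0; simpl; auto|].
destruct (classic (exists j, r j = x)) as [[j hj]|h].
- exists (max n (S j)); intros k hk [e|hk'].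
  + assert (k = j) by (apply inj; congruence); lia.
  + apply (IH k); auto; lia.
- exists n; intros k hk [e|hk']; [eauto|now apply (IH k)].
Qed.

Lemma tail_rt (R Q : V -> V -> Prop) (r : nat -> V) n : (forall k, n <= k -> Q (r k) (r (S k))) ->
  forall k, n <= k -> rt Q (r n) (r k).
Proof.
intros h k hk; induction hk; [apply rt_refl|].
apply rt_trans with (r m); auto; apply rt_step; auto.
Qed.

(* Otherwise infinitely many edges of the ray are bridges of [G - N].  The parts of [G - N]
   between two consecutive ones have no neighbour outside [N] other than two vertices of
   the ray, so each of them contains one of the finitely many neighbours of [N]. *)
Lemma ray_peq r (N : list V) : ray V G r -> exists n, forall k, n <= k ->
  peq (fun z => In z N) (r n) (r k).
Proof.
intros hr; destruct (ray_avoids G r N hr) as [n0 h0]; destruct hr as [inj gr].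
set (S := fun z => In z N) in *.
pose (e := fun i => gdel S (r i) (r (1 + i))).
pose (bridge := fun i => n0 <= i /\ ~ rt (e i) (r i) (r (1 + i))).
destruct (classic (exists n, n0 <= n /\ forall i, n <= i -> ~ bridge i)) as [[n [hn nb]]|inf].
{ exists n; intros k hk; induction hk as [|k hk IH].
  - apply peq_refl, h0; lia.
  - apply peq_trans with (r k); auto; splits; try (apply h0; lia).
    repeat split; try (apply h0; lia); intros u v.
    destruct (classic (r k = u /\ r (1 + k) = v \/ r k = v /\ r (1 + k) = u)) as [E|E].
    + assert (b : rt (e k) (r k) (r (1 + k))).
      { apply NNPP; intros h; apply (nb k hk); split; auto; lia. }
      destruct E as [[<- <-]|[<- <-]]; [exact b|].
      eapply rt_mono; [|exact b]; unfold e, gdel; intros a b'; tauto.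
    + apply rt_step; repeat split; auto; apply h0; lia. }
exfalso.
assert (next : forall i, n0 <= i -> exists j, i < j /\ bridge j).
{ intros i hi; apply NNPP; intros h; apply inf; exists (1 + i); split; [lia|].
  intros j hj hb; apply h; exists j; split; auto. }
(* The side of the ray edge number [i] towards the later part of the ray. *)
pose (K := fun i x => rt (e i) x (r (1 + i))).
assert (es : forall i a b, e i a b -> e i b a) by (intros i; apply gdel_sym).
assert (seg : forall i a b, n0 <= a -> a <= b -> b <= i \/ i < a -> rt (e i) (r a) (r b)).
{ intros i a b ha hab hi; induction hab as [|b hab IH]; [apply rt_refl|].
  apply rt_trans with (r b); [apply IH; lia|].
  apply rt_step; repeat split; try (apply h0; lia); auto.
  intros [[h h']|[h h']]; apply inj in h, h'; lia. }
assert (Kout : forall i j, bridge i -> n0 <= j -> j <= i -> ~ K i (r j)).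
{ intros i j [_ hb] hj hi h; apply hb; apply rt_trans with (r j); auto.
  apply rt_sym; auto; apply seg; auto. }
assert (Ktail : forall i j, n0 <= i -> i < j -> K i (r j)).
{ intros i j hi hj; apply rt_sym; auto; apply seg; lia. }
assert (Kdecr : forall i j, bridge i -> bridge j -> i < j -> forall x, K j x -> K i x).
{ intros i j bi bj hij x hx; apply rt_trans with (r (1 + j)); [|apply Ktail; [apply bi|lia]].
  unfold K in hx; apply clos_rt_rt1n in hx; remember (r (1 + j)) as y eqn:ey.
  induction hx as [x|x x' y h h' IH]; [apply rt_refl|].
  apply rt_trans with x'; [|now apply IH].
  apply clos_rt1n_rt in h'; rewrite ey in h'.
  (* The ray up to index [j] stays outside [K j], so a walk in [K j] cannot use the bridge number
     [i]. *)
  assert (nx : forall t, t <= j -> n0 <= t -> r t <> x /\ r t <> x').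
  { intros t ht ht'; split; intros E; apply (Kout j t); auto; rewrite E; unfold K; auto.
    apply rt_trans with x'; auto; now apply rt_step. }
  apply rt_step; destruct h as [g [s1 [s2 _]]]; repeat split; auto.
  destruct (nx i), (nx (1 + i)); try (destruct bi; lia); intuition. }
destruct (finite_nbrs N) as [M hM].
(* Otherwise the part of [K i] outside [K j] is closed under adjacency in [G] minus [r i] and
   [r (1 + j)]. It contains [r (1 + i)] but not [r (2 + j)], against 3-connectivity. *)
assert (witness : forall i j, bridge i -> bridge j -> i < j ->
  exists x, In x M /\ K i x /\ ~ K j x).
{ intros i j bi bj hij; apply NNPP; intros no.
  assert (closed : forall x y, K i x /\ ~ K j x ->
    G x y /\ ~ In x [r i; r (1 + j)] /\ ~ In y [r i; r (1 + j)] -> K i y /\ ~ K j y).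
  { intros x y [kx nx] [g [hx hy]].
    assert (sy : ~ S y).
    { intros sy; apply no; exists x; splits; auto; apply (hM y); auto. }
    assert (sx : ~ S x).
    { unfold K in kx; apply clos_rt_rt1n in kx; inversion kx; subst.
      - apply h0; destruct bi; lia.
      - now destruct H as [_ [h _]]. }
    simpl in hx, hy; split.
    - apply rt_trans with x; auto; apply rt_step, es; repeat split; auto.
      intros [[? _]|[_ ?]]; subst; tauto.
    - intros ky; apply nx; apply rt_trans with y; auto; apply rt_step; repeat split; auto.
      intros [[_ ?]|[? _]]; subst; tauto. }
  assert (rr : rt (fun a b => G a b /\ ~ In a [r i; r (1 + j)] /\ ~ In b [r i; r (1 + j)])
    (r (1 + i)) (r (2 + j))).
  { destruct bi as [bi _]; apply conn_minus; simpl; auto.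
    - intros [h|[h|[]]]; apply inj in h; lia.
    - intros [h|[h|[]]]; apply inj in h; lia. }
  apply clos_rt_rt1n in rr.
  assert (C : forall x y, clos_refl_trans_1n V (fun a b => G a b /\ ~ In a [r i; r (1 + j)] /\ ~ In b [r i; r (1 + j)]) x y ->
    K i x /\ ~ K j x -> K i y /\ ~ K j y).
  { intros x y h; induction h; eauto. }
  destruct (C _ _ rr) as [_ h].
  - split; [apply Ktail; [apply bi|lia]|apply Kout; auto; destruct bi; lia].
  - apply h, Ktail; [apply bj|lia]. }
(* Each bridge has a later one whose side contains strictly fewer neighbours of [N]. *)
assert (fin : forall m i, bridge i -> count V (K i) M < m -> False).
{ induction m as [|m IH]; intros i bi hm; [lia|].
  destruct (next i) as [j [hij bj]]; [apply bi|].
  destruct (witness i j bi bj hij) as [x [h1 [h2 h3]]].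
  apply (IH j bj).
  assert (count V (K j) M < count V (K i) M); [|lia].
  apply count_lt with x; auto; intros t _; now apply Kdecr. }
destruct (next n0 (le_n n0)) as [i [_ bi]].
exact (fin _ i bi (le_n _)).
Qed.

(** * Faithfulness *)

Section Geodesic.
Variables (F : V -> V -> Prop) (o : V).
Hypothesis FG : forall x y, F x y -> G x y.
Hypothesis Fconn : forall x, rt F o x.

Fixpoint ball n v : Prop :=
  match n with
  | 0 => v = o
  | S m => ball m v \/ exists u, ball m u /\ F u v
  end.

Definition sphere n v : Prop := ball n v /\ forall m, m < n -> ~ ball m v.

(** Directed walks along [down] from [o] are exactly the geodesics of [F] starting there. *)
Definition down u v : Prop := F u v /\ exists n, sphere n u /\ sphere (S n) v.

Lemma ball_mono m n v : m <= n -> ball m v -> ball n v.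
Proof. intros h; induction h; simpl; auto. Qed.

Lemma ball_cover v : exists n, ball n v.
Proof.
assert (r := Fconn v); apply clos_rt_rtn1 in r; induction r as [|y z g _ [n IH]].
- now exists 0.
- exists (S n); right; eauto.
Qed.

Lemma ball_cover_list (M : list V) : exists n, forall v, In v M -> ball n v.
Proof.
induction M as [|v M [n IH]]; [exists 0; intros v []|].
destruct (ball_cover v) as [m hm]; exists (max m n); intros w [<-|h].
- apply ball_mono with m; auto; lia.
- apply ball_mono with n; auto; lia.
Qed.

Lemma down_from_root n : forall v, ball n v -> rt down o v /\ exists m, sphere m v.
Proof.
induction n as [|n IH]; intros v hv.
- simpl in hv; subst v; split; [apply rt_refl|exists 0; split; [reflexivity|lia]].
- destruct (classic (ball n v)) as [h|h]; auto.
  destruct hv as [hv|[u [hu f]]]; [tauto|].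
  assert (sv : sphere (S n) v).
  { split; [right; eauto|intros m hm hb; apply h; apply ball_mono with m; auto; lia]. }
  split; [|eauto]; destruct (IH u hu) as [r _].
  apply rt_trans with u; auto; apply rt_step; split; auto; exists n; split; auto.
  split; auto; intros m hm hb; apply h; apply (ball_mono (S m)); auto.
  right; eauto.
Qed.

Lemma sphere_unique m n v : sphere m v -> sphere n v -> m = n.
Proof.
intros [h1 h2] [h3 h4]; destruct (Nat.lt_trichotomy m n) as [h|[h|h]]; auto.
- now destruct (h4 m).
- now destruct (h2 n).
Qed.

(** The distance from [o] grows at every step, so a walk that starts beyond the ball around [M]
    never enters it. *)
Lemma down_avoids m n u v (M : list V) : (forall w, In w M -> ball m w) -> m < n ->
  sphere n u -> rt down u v -> rt (fun a b => G a b /\ ~ In a M /\ ~ In b M) u v.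
Proof.
intros hM hm su r; apply clos_rt_rt1n in r; revert n hm su.
induction r as [u|u u' v [f [k [h1 h2]]] _ IH]; intros n hm su; [apply rt_refl|].
assert (k = n) by (eapply sphere_unique; eauto); subst k.
apply rt_trans with u'; [|apply (IH (S n)); auto].
apply rt_step; repeat split; auto; intros h; apply hM in h.
- now apply su in h.
- apply h2 in h; auto.
Qed.

(* Koenig's lemma for the tree of geodesics from [o] to the vertices of [r]. *)
Lemma geodesic_ray r : ray V G r -> exists r', ray V F r' /\ rays_equiv V G r r'.
Proof.
intros hr.
pose (inf := fun u => forall n, exists k, n <= k /\ rt down u (r k)).
(* The existential stands outside the implication so that choice yields a total successor
   function. *)
assert (nxt : forall n u, exists u', sphere n u /\ inf u ->
  F u u' /\ sphere (S n) u' /\ inf u').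
{ intros n u; apply NNPP; intros no.
  assert (su : sphere n u /\ inf u) by (apply NNPP; intros h; apply no; exists u; tauto).
  destruct su as [su iu], (finite_nbrs [u]) as [N hN].
  (* If no child of [u] satisfied [inf], then past some index [K] no vertex of [r] would descend
     from any of the finitely many children, hence none from [u] once the ray has left [u]. *)
  assert (B : forall M : list V, exists K, forall u', In u' M -> down u u' ->
    forall k, K <= k -> ~ rt down u' (r k)).
  { induction M as [|w M [K IH]]; [exists 0; intros u' []|].
    destruct (classic (down u w /\ inf w)) as [[[f [m [h1 h2]]] iw]|h].
    - destruct no; exists w; intros _; splits; auto.
      now replace n with m by (eapply sphere_unique; eauto).
    - destruct (classic (down u w)) as [dw|nw].
      + assert (nw : ~ inf w) by tauto.
        apply not_all_ex_not in nw; destruct nw as [K' hK'].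
        exists (max K K'); intros u' [<-|h'] du k hk.
        * intros rk; apply hK'; exists k; split; auto; lia.
        * apply (IH u' h' du); lia.
      + exists K; intros u' [<-|h'] du; [tauto|auto]. }
  destruct (B N) as [K hK], (ray_avoids G r [u] hr) as [n1 h1].
  destruct (iu (max K n1)) as [k [hk rk]].
  apply clos_rt_rt1n in rk; remember (r k) as y eqn:ey.
  destruct rk as [|u' y d rk].
  - apply (h1 k); [lia|now left].
  - apply clos_rt1n_rt in rk; subst y.
    apply (hK u') with k; auto; [|lia].
    apply (hN u); [now left|apply FG, d]. }
assert (i0 : sphere 0 o /\ inf o).
{ split; [split; [reflexivity|lia]|]; intros n; exists n; split; auto.
  destruct (ball_cover (r n)) as [m hm]; now apply (down_from_root m). }
pose (g := fun n u => proj1_sig (constructive_indefinite_description _ (nxt n u))).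
pose (r' := fix r' n := match n with 0 => o | S m => g m (r' m) end).
assert (hg : forall n, sphere n (r' n) /\ inf (r' n) ->
  F (r' n) (r' (S n)) /\ sphere (S n) (r' (S n)) /\ inf (r' (S n))).
{ intros n; exact (proj2_sig (constructive_indefinite_description _ (nxt n (r' n)))). }
assert (hr' : forall n, sphere n (r' n) /\ inf (r' n)).
{ induction n as [|n IH]; [exact i0|now apply hg]. }
exists r'; split; [split|].
- intros n m e; destruct (hr' n) as [h _], (hr' m) as [h' _]; rewrite e in h.
  eapply sphere_unique; eauto.
- intros n; now apply hg.
- intros M; destruct (ball_cover_list M) as [m hm].
  assert (av : forall n, m < n -> ~ In (r' n) M).
  { intros n hn h; apply hm in h; destruct (hr' n) as [[_ h'] _]; now apply (h' m). }
  destruct (ray_avoids G r M hr) as [n0 h0].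
  destruct (hr' (S m)) as [sm im]; destruct (im n0) as [k [hk rk]].
  exists (r' (S m)); split; [auto|split].
  + exists k; intros j hj; split; [auto|split; [apply h0; lia|]].
    apply rt_trans with (r k); [apply (down_avoids m (S m)); auto|].
    apply (tail_rt G (fun a b => G a b /\ ~ In a M /\ ~ In b M)); auto.
    intros t ht; repeat split; [apply hr|apply h0; lia|apply h0; lia].
  + exists (S m); intros j hj; split; [auto|split; [apply av; lia|]].
    apply (tail_rt G (fun a b => G a b /\ ~ In a M /\ ~ In b M)); auto.
    intros t ht; repeat split; [apply FG; now apply hg|apply av; lia|apply av; lia].
Qed.

End Geodesic.

(** By [ray_peq] each ray has a tail in one class of [peq] for [N]. Equivalence in [G] after
    deleting [u], [v] and [N] shows that deleting only the edge between [u] and [v] does not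
    separate these tails, so the classes coincide and [C] keeps them connected outside [N]. *)
Lemma rays_equiv_lift C (r1 r2 : nat -> V) :
  (forall M : list V, exists N : list V, incl M N /\ forall x y, peq (fun z => In z N) x y ->
    rt (fun a b => bichrom C a b /\ ~ In a N /\ ~ In b N) x y) ->
  ray V G r1 -> ray V G r2 -> rays_equiv V G r1 r2 -> rays_equiv V (bichrom C) r1 r2.
Proof.
intros sep h1 h2 eq12 M; destruct (sep M) as [N [MN hN]].
assert (toM : forall x y, peq (fun z => In z N) x y ->
  reach_in V (bichrom C) (fun u => ~ In u M) x y).
{ intros x y p; split; [|split]; try (intros h; apply MN in h; now apply p in h).
  eapply rt_mono; [|exact (hN x y p)]; intros a b [g [ha hb]]; repeat split; try apply g; auto. }
destruct (ray_peq r1 N h1) as [n1 p1], (ray_peq r2 N h2) as [n2 p2].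
assert (p12 : peq (fun z => In z N) (r1 n1) (r2 n2)).
{ split; [apply (p1 n1); auto|split; [apply (p2 n2); auto|]]; intros u v.
  destruct (eq12 (u :: v :: N)) as [w [_ [[m1 q1] [m2 q2]]]].
  assert (G' : forall x y, rt (fun a b => G a b /\ ~ In a (u :: v :: N) /\ ~ In b (u :: v :: N)) x y ->
    rt (gdel (fun z => In z N) u v) x y).
  { apply rt_mono; intros a b [g [ha hb]]; simpl in *; repeat split; auto.
    intros [[<- _]|[<- _]]; tauto. }
  apply rt_trans with (r1 (max n1 m1)); [apply p1; lia|].
  apply rt_trans with w.
  - apply rt_sym; [apply gdel_sym|]; apply G', q1; lia.
  - apply rt_trans with (r2 (max n2 m2)); [apply G', q2; lia|].
    apply rt_sym; [apply gdel_sym|]; apply p2; lia. }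
exists (r1 n1); split; [|split].
- intros h; apply MN in h; now apply p12 in h.
- exists n1; intros k hk; apply toM, p1, hk.
- exists n2; intros k hk; apply toM; apply peq_trans with (r2 n2); auto.
Qed.

Lemma rays_equiv_incl (F : V -> V -> Prop) r1 r2 : (forall x y, F x y -> G x y) ->
  rays_equiv V F r1 r2 -> rays_equiv V G r1 r2.
Proof.
intros FG h M.
assert (H : forall x y, reach_in V F (fun u => ~ In u M) x y ->
  reach_in V G (fun u => ~ In u M) x y).
{ intros x y [hx [hy r]]; split; [auto|split; [auto|]].
  eapply rt_mono; [|exact r]; intros a b [f n]; auto. }
destruct (h M) as [v [hv [[n1 h1] [n2 h2]]]]; exists v; splits; eauto.
Qed.

Lemma faithful_bipartite : exists F : V -> V -> Prop,
  simple_graph V F /\ (forall x y, F x y -> G x y) /\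
  k_connected V 2 F /\ bipartite V F /\ faithful V G F.
Proof.
destruct bipartite_skeleton as [C [conn sep]]; exists (bichrom C).
assert (FG : forall x y, bichrom C x y -> G x y) by (intros x y [g _]; exact g).
assert (Frt : forall x y, rt (bichrom C) x y).
{ intros x y; destruct (two_nbrs x y) as [s [g n]].
  assert (xs : x <> s) by (intros ->; exact (Girr _ g)).
  eapply rt_mono; [|apply (conn s x y)]; auto; intros a b [h _]; exact h. }
destruct Gconn as [[l [ndl hl]] _]; destruct l as [|o l'] eqn:el; [simpl in hl; lia|].
rewrite <- el in *; splits; auto.
- split; [apply bichrom_sym|]; intros x [g _]; exact (Girr x g).
- split; [exists l; split; auto; lia|].
  intros M hM; destruct M as [|s [|s' M]]; [| |simpl in hM; lia].
  + split; [exists o; auto|]; intros x y hx hy; split; [auto|split; auto].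
    eapply rt_mono; [|apply (Frt x y)]; simpl; auto.
  + split.
    * destruct (two_nbrs s s) as [w [_ n]]; exists w; simpl; intros [h|[]]; auto.
    * simpl; intros x y hx hy; split; [auto|split; auto].
      eapply rt_mono; [|apply (conn s x y)]; auto.
      intros a b [h [ha hb]]; split; [auto|split; intros [e|[]]; auto].
- exists C; intros x y [_ h]; exact h.
- split.
  + intros r hr; apply (geodesic_ray (bichrom C) o); auto.
  + intros r1 r2 [i1 f1] [i2 f2]; split.
    * now apply rays_equiv_incl.
    * apply rays_equiv_lift; auto; split; auto.
Qed.

End Cubic.

Theorem theorem6 (V : Type) (G : V -> V -> Prop) :
  simple_graph V G ->
  infinite_vertices V ->
  cubic V G ->
  k_connected V 3 G ->
  exists F : V -> V -> Prop,
    (* spanning subgraph: same vertex set V, edges a subset of G's *)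
    simple_graph V F /\ (forall x y, F x y -> G x y) /\
    k_connected V 2 F /\ bipartite V F /\ faithful V G F.
Proof.
intros [Gsym Girr] _ Gcub Gconn.
exact (faithful_bipartite V G Gsym Girr Gcub Gconn).
Qed.
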